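(* Let $G$ be a split semisimple linear algebraic group over a field $k$ of characteristic $0$ with split maximal torus $T$, Borel subgroup $B\supset T$, root system $\Sigma$ and Weyl group $W$. Let $(\phi,\gamma)\colon F_1/R_1\to F_2/R_2$ be a morphism of formal group laws of additive type, and assume that the formal group rings $S_1=S_{F_1}(T^* )$ and $S_2=S_{F_2}(T^* )$ are $\Sigma$-regular. Let $\mathtt{h}_1$ be a free algebraic oriented cohomology theory with formal group law $F_1$ and $\mathtt{h}_2$ an algebraic oriented cohomology theory with formal group law $F_2$, and let $\mathcal{C}_T\colon(\mathtt{h}_1)_T(G/B)\to(\mathtt{h}_2)_T(G/B)$ be the localized multiplicative operation induced by $(\phi,\gamma)$. For $\alpha\in\Sigma$ let $Y_\alpha$ be the push-pull element, acting on $(\mathtt{h}_1)_T(G/B)$ and on $(\mathtt{h}_2)_T(G/B)$ by the Hecke action $\bullet$. Then \[ \mathrm{itd}(x_\alpha)\bullet\mathcal{C}_T(Y_\alpha\bullet z)=Y_\alpha\bullet\mathcal{C}_T(z)\qquad\text{for all }z\in(\mathtt{h}_1)_T(G/B), \] where $\mathrm{itd}(x)=\gamma(x)/x\in R_2[[x]]$.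
   Context: Formal group laws. A formal group law $F/R$ over a commutative unital ring $R$ is a power series $F(x,y)=x+_Fy\in R[[x,y]]$ that is commutative, associative and satisfies $x+_F0=x$. It is of additive type if its formal inverse is the usual additive inverse, i.e. $-_Fx=-x$. A morphism $(\phi,\gamma)\colon F_1/R_1\to F_2/R_2$ is a ring homomorphism $\phi\colon R_1\to R_2$ together with a series $\gamma\in xR_2[[x]]$ such that $\phi(F_1)(\gamma(x),\gamma(y))=\gamma(F_2(x,y))$, where $\phi(F_1)$ is obtained by applying $\phi$ to coefficients. Formal group rings. $T^*$ is the character lattice. $S=S_F(T^* )=R[[x_\lambda]]_{\lambda\in T^*}/\overline{J}$, where $R[[x_\lambda]]_{\lambda\in T^*}$ is the completion of the polynomial ring $R[x_\lambda]_{\lambda\in T^*}$ with respect to the kernel of $x_\lambda\mapsto0$, and $\overline{J}$ is the closure of the ideal generated by $x_0$ and all $x_{\lambda+\mu}-(x_\lambda+_Fx_\mu)$. $W$ acts on $S$ by $w(x_\lambda)=x_{w(\lambda)}$. $S$ is $\Sigma$-regular if $x_\alpha$ is not a zero divisor in $S$ for every $\alpha\in\Sigma$. A morphism $(\phi,\gamma)$ induces the ring homomorphism $\mathcal{C}\colon S_1\to S_2$ sending the class of a power series $f$ in the $x_\lambda$ to the class of the series obtained by applying $\phi$ to the coefficients of $f$ and substituting $\gamma(x_\lambda)$ for each $x_\lambda$. Demazure algebra and its dual. $Q=S[\tfrac1{x_\alpha},\alpha\in\Sigma]$; $Q_W$ is the free left $Q$-module with basis $\{\delta_w\}_{w\in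 W}$ and product determined by $\delta_w\delta_v=\delta_{wv}$, $\delta_wq=w(q)\delta_w$ ($q\in Q$); $S_W\subset Q_W$ is the $S$-span of the $\delta_w$. The push-pull element of a root $\alpha$ is $Y_\alpha=\tfrac1{x_{-\alpha}}+\tfrac1{x_\alpha}\delta_{s_\alpha}\in Q_W$, with $s_\alpha\in W$ the reflection of $\alpha$. $\mathbb{D}_F\subset Q_W$ is the subalgebra generated by $S$ and all $Y_\alpha$, $\alpha\in\Sigma$. Let $\{f_w\}_{w\in W}$ be the basis dual to $\{\delta_w\}$, so that $S_W^\star=\mathrm{Hom}_S(S_W,S)=\bigoplus_wSf_w\subset Q_W^*=\mathrm{Hom}_Q(Q_W,Q)$. The inclusion $S_W\subset\mathbb{D}_F$ induces an inclusion of $S$-duals $\mathbb{D}_F^\star\hookrightarrow S_W^\star$. Hecke action. $Q_W$ acts on $Q_W^*$ by $(z\bullet f)(z')=f(z'z)$ for $z,z'\in Q_W$, $f\in Q_W^*$. Thus $q\bullet f_w=w(q)f_w$ for $q\in Q$ and $\delta_w\bullet f_v=f_{vw^{-1}}$, and the action is $Q$-linear for the left $Q$-module structure of $Q_W^*$. It restricts to an action of $\mathbb{D}_F$ on $\mathbb{D}_F^\star$. Oriented cohomology. An algebraic oriented cohomology theory $\mathtt{h}$ (in the sense of Levine–Morel, satisfying the localization axiom and generically constant) over $k$ has a formal group law $F$ over $R=\mathtt{h}(\mathrm{Spec}\,k)$; it is free if $\mathtt{h}=\Omega\otimes_{\mathbb{L}}R$ with $\Omega$ algebraic cobordism and $\mathbb{L}$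 the Lazard ring. $\mathtt{h}_T$ is the associated $T$-equivariant theory (Borel construction), assumed Chern-complete, so that $\mathtt{h}_T(\mathrm{Spec}\,k)=S$. Under $\Sigma$-regularity there is a known identification $\mathtt{h}_T(G/B)\simeq\mathbb{D}_F^\star\subset S_W^\star\simeq\mathtt{h}_T((G/B)^T)$, the inclusion being the pull-back to the $T$-fixed points. The localized multiplicative operation $\mathcal{C}_T$ induced by $(\phi,\gamma)$ is the restriction to $(\mathtt{h}_1)_T(G/B)\to(\mathtt{h}_2)_T(G/B)$ of the map $(S_1)_W^\star\to(S_2)_W^\star$, $\sum_wp_wf_w\mapsto\sum_w\mathcal{C}(p_w)f_w$ (the paper shows that this map indeed restricts). *)

(* Defs.v *)
From HB Require Import structures.
From mathcomp Require Import all_boot all_order all_algebra all_fingroup.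
From mathcomp Require Import finmap.
From mathcomp Require Import boolp ring.
From mathcomp.multinomials Require Import monalg.

Set Implicit Arguments.
Unset Strict Implicit.
Unset Printing Implicit Defensive.

Import GRing.Theory.
Local Open Scope ring_scope.
Local Open Scope quotient_scope.

(* [{malg R[K]}] carries a ring structure only for nonzero [R]. The alias [pol]
   provides the one of R[x_i, i in I] for an arbitrary commutative ring [R]. *)
Definition pol (I : choiceType) (R : comPzRingType) : Type :=
  {malg R[{cmonom I}]}.
HB.instance Definition _ I R := GRing.Zmodule.on (pol I R).

HB.lock Definition monom (I : choiceType) (R : comPzRingType) (c : R)
  (k : {cmonom I}) : pol I R := << c *g k >>.
Canonical monom_unlockable := Unlockable monom.unlock.
Arguments monom {I R} c k.

HB.lock Definition pmul (I : choiceType) (R : comPzRingType) (f g : pol I R) :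
    pol I R :=
  \sum_(k <- msupp f) \sum_(l <- msupp g) monom (f@_k * g@_l) (mmul k l).
Canonical pmul_unlockable := Unlockable pmul.unlock.
Arguments pmul {I R} f g.

Section PolRing.
Context {I : choiceType} {R : comPzRingType}.
Local Notation K := {cmonom I}.
Implicit Types (f g h : pol I R).

Lemma monomD k : {morph (fun c : R => monom c k : pol I R) : a b / a + b}.
Proof. by rewrite monom.unlock; exact: monalgUD. Qed.

Lemma monom0 k : monom 0 k = 0 :> pol I R.
Proof. by rewrite monom.unlock; exact: monalgU0. Qed.

Lemma pol_ind (P : pol I R -> Prop) :
  P 0 -> (forall f g, P f -> P g -> P (f + g)) ->
  (forall c k, P (monom c k)) -> forall f, P f.
Proof.
move=> P0 PD PU f; rewrite (monalgE f).
by elim/big_ind: _ => // k _; move: (PU f@_k k); rewrite monom.unlock.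
Qed.

Section PolSum.
Context {V : zmodType} (F : K -> R -> V).
Hypothesis FD : forall k, {morph F k : a b / a + b}.

Let F0 k : F k 0 = 0.
Proof. by apply: (addIr (F k 0)); rewrite -FD !add0r. Qed.

Lemma pol_sumEw (d : {fset K}) f : (msupp f `<=` d)%fset ->
  \sum_(k <- msupp f) F k f@_k = \sum_(k <- d) F k f@_k.
Proof.
move=> fd; apply/big_fset_incl => // k _ /mcoeff_outdom ->.
exact: F0.
Qed.

Lemma pol_sumD f g : \sum_(k <- msupp (f + g)) F k (f + g)@_k
  = \sum_(k <- msupp f) F k f@_k + \sum_(k <- msupp g) F k g@_k.
Proof.
rewrite (pol_sumEw (msuppD_le _ _)) (pol_sumEw (fsubsetUl (msupp f) (msupp g))).
rewrite (pol_sumEw (fsubsetUr (msupp f) (msupp g))) -big_split /=.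
by apply: eq_bigr => k _; rewrite mcoeffD FD.
Qed.

Lemma pol_sumU c k :
  \sum_(l <- msupp (monom c k)) F l (monom c k)@_l = F k c.
Proof.
by rewrite monom.unlock (pol_sumEw msuppU_le) big_seq_fset1 mcoeffUU.
Qed.

End PolSum.

Lemma pmulDl : left_distributive (@pmul I R) +%R.
Proof.
move=> f g h; rewrite pmul.unlock; apply: (@pol_sumD _ (fun k a =>
  \sum_(l <- msupp h) monom (a * h@_l) (mmul k l))) => k a b.
by rewrite -big_split; apply: eq_bigr => l _; rewrite mulrDl monomD.
Qed.

Lemma pmulC : commutative (@pmul I R).
Proof.
move=> f g; rewrite pmul.unlock exchange_big; apply: eq_bigr => l _.
by apply: eq_bigr => k _; rewrite mulrC mulmC.
Qed.

Lemma pmulDr : right_distributive (@pmul I R) +%R.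
Proof. by move=> f g h; rewrite pmulC pmulDl -!(pmulC f). Qed.

Lemma pmulUU a b k l : pmul (monom a k) (monom b l) = monom (a * b) (mmul k l)
  :> pol I R.
Proof.
rewrite pmul.unlock (pol_sumU (F := fun k' a' => \sum_(l' <- msupp (monom b l : pol I R))
  monom (a' * (monom b l : pol I R)@_l') (mmul k' l'))); last first.
  by move=> k' a' b'; rewrite -big_split; apply: eq_bigr => l' _; rewrite mulrDl monomD.
rewrite (pol_sumU (F := fun l' b' => monom (a * b') (mmul k l') : pol I R)) // => l' b' c'.
by rewrite mulrDr monomD.
Qed.

Lemma pmul0l f : pmul 0 f = 0.
Proof. by rewrite pmul.unlock msupp0 big_seq_fset0. Qed.

Lemma pmul0r f : pmul f 0 = 0.
Proof. by rewrite pmulC pmul0l. Qed.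

Lemma pmulA : associative (@pmul I R).
Proof.
elim/pol_ind => [g h|f f' IHf IHf' g h|a k]; first by rewrite !pmul0l.
  by rewrite !pmulDl IHf IHf'.
elim/pol_ind => [h|g g' IHg IHg' h|b l]; first by rewrite pmul0r !pmul0l pmul0r.
  by rewrite pmulDr !pmulDl pmulDr IHg IHg'.
elim/pol_ind => [|h h' IHh IHh'|c m]; first by rewrite !pmul0r.
  by rewrite !pmulDr IHh IHh'.
by rewrite !pmulUU mulrA mulmA.
Qed.

Lemma pmul1 : left_id (monom 1 mone) (@pmul I R).
Proof.
elim/pol_ind => [|f g IHf IHg|c k]; first by rewrite pmul0r.
  by rewrite pmulDr IHf IHg.
by rewrite pmulUU mul1r mul1m.
Qed.

HB.instance Definition _ :=
  GRing.Zmodule_isComPzRing.Build (pol I R) pmulA pmulC pmul1 pmulDl.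

Definition homog d f : Prop := forall k, k \in msupp f -> mdeg k = d.

Lemma homog0 d : homog d 0.
Proof. by move=> k; rewrite msupp0 in_fset0. Qed.

Lemma homogD d f g : homog d f -> homog d g -> homog d (f + g).
Proof.
move=> fd gd k kfg; have := fsubsetP (msuppD_le f g) k kfg.
by rewrite in_fsetU => /orP[/fd|/gd].
Qed.

Lemma homogN d f : homog d f -> homog d (- f).
Proof. by move=> fd k; rewrite msuppN => /fd. Qed.

Lemma homog_sum d T (r : seq T) (P : pred T) (F : T -> pol I R) :
  (forall i, P i -> homog d (F i)) -> homog d (\sum_(i <- r | P i) F i).
Proof.
by move=> Fd; elim/big_ind: _ => //; [apply: homog0 | move=> *; apply: homogD].
Qed.

Lemma homogU c (k : K) : homog (mdeg k) (monom c k : pol I R).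
Proof.
by rewrite monom.unlock => l lk; move: (fsubsetP msuppU_le l lk); rewrite in_fset1 => /eqP ->.
Qed.

Lemma homogM d e f g : homog d f -> homog e g -> homog (d + e) (f * g).
Proof.
move=> fd ge; rewrite /GRing.mul /= pmul.unlock big_seq_cond; apply: homog_sum => k.
rewrite andbT => kf; rewrite big_seq_cond; apply: homog_sum => l.
rewrite andbT => lg; rewrite -(fd k) // -(ge l) // -mdegM; exact: homogU.
Qed.

End PolRing.

(* Power series over [R] in variables indexed by [I]: the completion of R[x_i]
   with respect to the ideal generated by the variables. An element is the
   family of its homogeneous parts, each of which is a polynomial. *)
Record psr (I : choiceType) (R : comPzRingType) := PSeries {
  hpart :> nat -> pol I R;
  hpart_homog : forall d, homog d (hpart d) }.

HB.instance Definition _ I R := gen_eqMixin (psr I R).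
HB.instance Definition _ I R := gen_choiceMixin (psr I R).

Section PowerSeriesRing.
Context {I : choiceType} {R : comPzRingType}.
Implicit Types (f g h : psr I R).

Lemma psrP f g : (forall d, f d = g d) -> f = g.
Proof.
case: f g => [f fP] [g gP] /= /funext fg; case: g / fg in gP *.
by congr PSeries; apply: Prop_irrelevance.
Qed.

Definition ps_zero : psr I R := PSeries (fun d => @homog0 I R d).
Definition ps_opp f : psr I R := PSeries (fun d => homogN (@hpart_homog _ _ f d)).
Definition ps_add f g : psr I R :=
  PSeries (fun d => homogD (@hpart_homog _ _ f d) (@hpart_homog _ _ g d)).

Definition ps_mul_part f g d : pol I R := \sum_(i < d.+1) f i * g (d - i)%N.
Lemma ps_mul_homog f g d : homog d (ps_mul_part f g d).
Proof.
apply: homog_sum => i _; rewrite -[X in homog X _](subnKC (leq_ord i)).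
by apply: homogM; apply: hpart_homog.
Qed.
Definition ps_mul f g : psr I R := PSeries (@ps_mul_homog f g).

Definition psC_part (c : R) (d : nat) : pol I R := if d is 0 then monom c mone else 0.
Lemma psC_homog c d : homog d (psC_part c d).
Proof.
by case: d => [|d] /=; [rewrite -(@mdeg1 I); apply: homogU|apply: homog0].
Qed.
Definition psC c : psr I R := PSeries (@psC_homog c).

Definition psX_part (i : I) (d : nat) : pol I R :=
  if d is 1 then monom 1 (ucm i) else 0.
Lemma psX_homog i d : homog d (psX_part i d).
Proof.
case: d => [|[|d]] /=; [exact: homog0| |exact: homog0].
by rewrite -(mdegU i); apply: homogU.
Qed.
Definition psX i : psr I R := PSeries (@psX_homog i).

Lemma ps_addA : associative ps_add.
Proof. by move=> f g h; apply: psrP => d; apply: addrA. Qed.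
Lemma ps_addC : commutative ps_add.
Proof. by move=> f g; apply: psrP => d; apply: addrC. Qed.
Lemma ps_add0 : left_id ps_zero ps_add.
Proof. by move=> f; apply: psrP => d; apply: add0r. Qed.
Lemma ps_addN : left_inverse ps_zero ps_opp ps_add.
Proof. by move=> f; apply: psrP => d; apply: addNr. Qed.
HB.instance Definition _ :=
  GRing.isZmodule.Build (psr I R) ps_addA ps_addC ps_add0 ps_addN.

Lemma ps_mul_rev f g d : ps_mul_part f g d = \sum_(i < d.+1) f (d - i)%N * g i.
Proof.
rewrite /ps_mul_part (reindex_inj rev_ord_inj); apply: eq_bigr => i _ /=.
by rewrite subSS subKn // -ltnS.
Qed.

Lemma ps_mulC : commutative ps_mul.
Proof.
move=> f g; apply: psrP => d; rewrite /= ps_mul_rev.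
by apply: eq_bigr => i _; rewrite mulrC.
Qed.

Lemma ps_mulA : associative ps_mul.
Proof.
move=> f g h; apply: psrP => d /=; rewrite [RHS]ps_mul_rev.
pose G i j := f i * (g (d - i - j)%N * h j).
transitivity (\sum_(i < d.+1) \sum_(j < d.+1 | (j <= d - i)%N) G i j).
  apply: eq_bigr => i _; rewrite /= ps_mul_rev big_distrr /=.
  by rewrite (big_ord_narrow_leq (leq_subr _ _)).
rewrite (exchange_big_dep predT) //=; apply: eq_bigr => k _.
transitivity (\sum_(j < d.+1 | (j <= d - k)%N) G j k).
  apply: eq_bigl => j; rewrite -ltnS -(ltnS j) -!subSn ?leq_ord //.
  by rewrite -subn_gt0 -(subn_gt0 j) -!subnDA addnC.
rewrite (big_ord_narrow_leq (leq_subr _ _)) /= /ps_mul_part big_distrl /=.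
by apply: eq_bigr => j _; rewrite /G -!subnDA addnC mulrA.
Qed.

Lemma ps_mul1 : left_id (psC 1) ps_mul.
Proof.
move=> f; apply: psrP => d; rewrite /= /ps_mul_part big_ord_recl subn0 mul1r.
by rewrite big1 ?addr0 // => i _; rewrite mul0r.
Qed.

Lemma ps_mulDl : left_distributive ps_mul +%R.
Proof.
move=> f g h; apply: psrP => d; rewrite [RHS]/= /ps_mul_part -big_split.
by apply: eq_bigr => i _; rewrite mulrDl.
Qed.

HB.instance Definition _ := GRing.Zmodule_isComPzRing.Build (psr I R)
  ps_mulA ps_mulC ps_mul1 ps_mulDl.
End PowerSeriesRing.

Section Substitution.
Context {I J : choiceType} {R R' : comPzRingType}.
Variables (phi : R -> R') (g : I -> psr J R').

Definition pol_eval (p : pol I R) : psr J R' :=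
  \sum_(k <- msupp p) psC (phi p@_k) * \prod_(i <- finsupp k) g i ^+ k i.

Definition subst_part (f : psr I R) (d : nat) : pol J R' :=
  \sum_(e < d.+1) pol_eval (f e) d.

Lemma subst_homog f d : homog d (subst_part f d).
Proof. by apply: homog_sum => e _; apply: hpart_homog. Qed.

(* [subst phi g f]: apply [phi] to the coefficients of [f] and replace each
   variable x_i by [g i]. It is only used when the [g i] have no constant term;
   the monomials of degree e > d then contribute nothing in degree d. *)
Definition subst (f : psr I R) : psr J R' := PSeries (@subst_homog f).

End Substitution.

Section UnivariateSeries.
Context {R : comPzRingType}.

Definition umonom (d : nat) : {cmonom unit} := iter d (mmul (ucm tt)) mone.

Lemma mdeg_umonom d : mdeg (umonom d) = d.
Proof. by elim: d => [|d IHd]; rewrite ?mdeg1 //= mdegM mdegU IHd. Qed.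

Definition useries_part (c : nat -> R) d : pol unit R := monom (c d) (umonom d).

Lemma useries_homog c d : homog d (useries_part c d).
Proof. by rewrite -[d in homog d](mdeg_umonom d); apply: homogU. Qed.

Definition useries (c : nat -> R) : psr unit R := PSeries (@useries_homog c).

Definition ucoef (f : psr unit R) (d : nat) : R := (f d : {malg R[_]})@_(umonom d).

(* gamma(x)/x, for a series gamma without constant term *)
Definition itd (gamma : psr unit R) : psr unit R :=
  useries (fun d => ucoef gamma d.+1).

(* f(g), for a univariate f *)
Definition ucomp {J : choiceType} (f : psr unit R) (g : psr J R) : psr J R :=
  subst idfun (fun=> g) f.

End UnivariateSeries.

Section FormalGroupLaw.
Context {R : comPzRingType}.

(* F(f, g), for a series F in two variables *)
Definition fgl_add {J : choiceType} (F : psr bool R) (f g : psr J R) : psr J R :=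
  subst idfun (fun b : bool => if b then g else f) F.

Record is_fgl (F : psr bool R) : Prop := IsFGL {
  fgl_addC : fgl_add F (psX false) (psX true) = fgl_add F (psX true) (psX false);
  fgl_addA : let x := psX (0 : 'I_3) in let y := psX (1 : 'I_3) in
    let z := psX (2 : 'I_3) in
    fgl_add F (fgl_add F x y) z = fgl_add F x (fgl_add F y z);
  fgl_add0 : fgl_add F (psX tt) 0 = psX tt }.

Definition is_formal_inverse (F : psr bool R) (i : psr unit R) : Prop :=
  i 0%N = 0 /\ fgl_add F (psX tt) i = 0.

Definition additive_type (F : psr bool R) : Prop :=
  is_formal_inverse F (- psX tt).

End FormalGroupLaw.

Definition is_fgl_morphism (R1 R2 : comPzRingType) (F1 : psr bool R1)
    (F2 : psr bool R2) (phi : {rmorphism R1 -> R2}) (gamma : psr unit R2) : Prop :=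
  gamma 0%N = 0 /\
  subst phi (fun b : bool => ucomp gamma (psX b)) F1
    = ucomp gamma (fgl_add F2 (psX false) (psX true)).

Section FormalGroupRing.
Variables (n : nat) (R : comPzRingType) (F : psr bool R).
Local Notation A := (psr 'cV[int]_n R).

Definition fgr_relation (f : A) : Prop :=
  f = psX 0 \/ exists l m, f = psX (l + m) - fgl_add F (psX l) (psX m).

Definition is_ideal (P : A -> Prop) : Prop :=
  [/\ P 0, forall f g, P f -> P g -> P (f + g) & forall f g, P g -> P (f * g)].

Definition fgr_J (f : A) : Prop :=
  forall P, is_ideal P -> (forall g, fgr_relation g -> P g) -> P f.

(* [f] is in the closure of J when it agrees with an element of J modulo the
   series of order at least d, for every d. *)
Definition fgr_Jbar : {pred A} :=
  fun f => `[< forall d, exists2 g, fgr_J g & forall e, (e < d)%N -> f e = g e >].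

Lemma fgr_J_ideal : is_ideal fgr_J.
Proof.
split=> [P [] //|f g Jf Jg P PI Pr|f g Jg P PI Pr]; case: (PI) => P0 PD PM.
  by apply: PD; [apply: Jf|apply: Jg].
by apply: PM; apply: Jg.
Qed.

Lemma fgr_JbarM f g : fgr_Jbar g -> fgr_Jbar (f * g).
Proof.
have [_ _ JM] := fgr_J_ideal; move=> /asboolP Jg; apply/asboolP => d.
have [j Jj gj] := Jg d; exists (f * j); first exact: JM.
move=> e ed; apply: eq_bigr => i _; rewrite gj //.
exact: leq_ltn_trans (leq_subr _ _) ed.
Qed.

Lemma fgr_Jbar_zmod_closed : zmod_closed fgr_Jbar.
Proof.
have [J0 JD JM] := fgr_J_ideal; split=> [|f g /asboolP Jf Jg].
  by apply/asboolP => d; exists 0.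
have /asboolP {}Jg : fgr_Jbar (-1 * g) by apply: fgr_JbarM.
apply/asboolP => d; have [f' Jf' ff'] := Jf d; have [g' Jg' gg'] := Jg d.
exists (f' + g') => [|e ed]; first exact: JD.
by rewrite -[- g]mulN1r /= ff' // -gg'.
Qed.

HB.instance Definition _ :=
  GRing.isZmodClosed.Build A fgr_Jbar fgr_Jbar_zmod_closed.

(* the formal group ring R[[x_l]]_{l in Z^n} / Jbar of T^* = Z^n *)
Definition fgr : Type := {ideal_quot fgr_Jbar}.
HB.instance Definition _ := GRing.Zmodule.on fgr.

Definition fgr_pi (f : A) : fgr := \pi_{ideal_quot fgr_Jbar} f.
Definition fgr_repr (s : fgr) : A := generic_quotient.repr (s : {ideal_quot fgr_Jbar}).

Lemma fgr_reprK : cancel fgr_repr fgr_pi.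
Proof. exact: reprK. Qed.

Lemma fgr_piP f g : reflect (fgr_pi f = fgr_pi g) (f - g \in fgr_Jbar).
Proof. by rewrite Quotient.idealrBE; apply: eqP. Qed.

Lemma fgr_piD : {morph fgr_pi : f g / f + g}.
Proof. exact: Quotient.pi_add. Qed.

Definition fgr_mul (s t : fgr) : fgr := fgr_pi (fgr_repr s * fgr_repr t).

Lemma fgr_piM f g : fgr_pi (f * g) = fgr_mul (fgr_pi f) (fgr_pi g).
Proof.
apply/fgr_piP; set f' := fgr_repr _; set g' := fgr_repr _.
have ff' : f - f' \in fgr_Jbar by apply/fgr_piP; rewrite fgr_reprK.
have gg' : g - g' \in fgr_Jbar by apply/fgr_piP; rewrite fgr_reprK.
have -> : f * g - f' * g' = g * (f - f') + f' * (g - g').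
  by rewrite !mulrBr [g * f]mulrC [g * f']mulrC addrA subrK.
by apply: rpredD; apply: fgr_JbarM.
Qed.

Lemma fgr_mulC : commutative fgr_mul.
Proof. by move=> s t; rewrite /fgr_mul mulrC. Qed.
Lemma fgr_mulA : associative fgr_mul.
Proof.
move=> s t u; rewrite -[s]fgr_reprK -[t]fgr_reprK -[u]fgr_reprK.
by rewrite -!fgr_piM mulrA.
Qed.
Lemma fgr_mul1 : left_id (fgr_pi 1) fgr_mul.
Proof. by move=> s; rewrite -[s]fgr_reprK -fgr_piM mul1r. Qed.
Lemma fgr_mulDl : left_distributive fgr_mul +%R.
Proof.
move=> s t u; rewrite -[s]fgr_reprK -[t]fgr_reprK -[u]fgr_reprK.
by rewrite -fgr_piD -!fgr_piM -fgr_piD mulrDl.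
Qed.
HB.instance Definition _ :=
  GRing.Zmodule_isComPzRing.Build fgr fgr_mulA fgr_mulC fgr_mul1 fgr_mulDl.

Definition fgr_x (l : 'cV[int]_n) : fgr := fgr_pi (psX l).

(* The action w(x_l) = x_{w(l)} of an endomorphism of the lattice. The
   substitution sends Jbar to Jbar, so the choice of representative is
   immaterial. *)
Definition fgr_act (w : 'M[int]_n) (s : fgr) : fgr :=
  fgr_pi (subst idfun (fun l => psX (w *m l)) (fgr_repr s)).

(* the class of f(x_l), for a univariate series f *)
Definition fgr_ueval (f : psr unit R) (l : 'cV[int]_n) : fgr :=
  fgr_pi (ucomp f (psX l)).

End FormalGroupRing.

(* C(s): apply phi to the coefficients and replace x_l by gamma(x_l). As for
   [fgr_act], the class obtained does not depend on the representative when
   (phi, gamma) is a morphism. *)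
Definition fgr_map (n : nat) (R1 R2 : comPzRingType) (F1 : psr bool R1)
    (F2 : psr bool R2) (phi : R1 -> R2) (gamma : psr unit R2)
    (s : fgr n F1) : fgr n F2 :=
  fgr_pi F2 (subst phi (fun l => ucomp gamma (psX l)) (fgr_repr s)).

(* S[1/a, a in A], as fractions s/d whose denominator is a product of elements
   of [A]; the elements of [A] may be zero divisors. *)
Section Localization.
Variables (S : comPzRingType) (A : S -> Prop).

Inductive denom : S -> Prop :=
  | denom1 : denom 1
  | denomM a d : A a -> denom d -> denom (a * d).

Lemma denom_mul d e : denom d -> denom e -> denom (d * e).
Proof.
by elim=> [|a c Aa _ IHc] dE; rewrite ?mul1r // -mulrA; apply/denomM/IHc.
Qed.

Lemma denom_gen a : A a -> denom a.
Proof. by move=> Aa; rewrite -[a]mulr1; apply/denomM/denom1. Qed.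

Definition den : Type := {d : S | `[< denom d >]}.
HB.instance Definition _ := SubType.on den.
HB.instance Definition _ := [Choice of den by <:].

Lemma denP (d : den) : denom (val d).
Proof. exact/asboolP/(valP d). Qed.

Definition den_of d (Md : denom d) : den := exist _ d (introT (asboolP _) Md).
Definition den1 : den := den_of denom1.
Definition denmul (d e : den) : den := den_of (denom_mul (denP d) (denP e)).

Lemma val_den1 : val den1 = 1. Proof. by []. Qed.
Lemma val_denmul d e : val (denmul d e) = val d * val e. Proof. by []. Qed.
Definition val_denE := (val_den1, val_denmul).

Definition loc_eq (p q : S * den) : bool :=
  `[< exists2 u, denom u & u * (p.1 * val q.2) = u * (q.1 * val p.2) >].

Lemma loc_eq_equiv : equiv_class_of loc_eq.
Proof.
split=> [p|p q|q p r].
- by apply/asboolP; exists 1 => //; exact: denom1.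
- by apply/asboolP/asboolP => -[u Mu e]; exists u.
move=> /asboolP [u Mu pq] /asboolP [v Mv qr]; apply/asboolP.
exists (val q.2 * (u * v)); first exact/denom_mul/denom_mul/Mv/Mu/denP.
transitivity (v * val r.2 * (u * (p.1 * val q.2))); first by ring.
rewrite pq; transitivity (u * val p.2 * (v * (q.1 * val r.2))); first by ring.
by rewrite qr; ring.
Qed.

Canonical loc_equiv := EquivRelPack loc_eq_equiv.
Canonical loc_encModRel := defaultEncModRel loc_eq.

Definition loc : Type := {eq_quot loc_eq}.
HB.instance Definition _ := Choice.on loc.
HB.instance Definition _ := EqQuotient.on loc.

Definition frac (s : S) (d : den) : loc := \pi_{eq_quot loc_eq} (s, d).
Definition loc_repr (q : loc) : S * den :=
  generic_quotient.repr (q : {eq_quot loc_eq}).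
Definition loc_num q : S := (loc_repr q).1.
Definition loc_den q : den := (loc_repr q).2.

Lemma fracK q : frac (loc_num q) (loc_den q) = q.
Proof. by rewrite /frac -surjective_pairing; exact: reprK. Qed.

Lemma fracP s d t e :
  frac s d = frac t e <-> exists2 u, denom u & u * (s * val e) = u * (t * val d).
Proof.
split; first by move=> /eqP; rewrite piE => /asboolP.
by move=> h; apply/eqP; rewrite piE; apply/asboolP.
Qed.

Lemma frac_eq s d t e : s * val e = t * val d -> frac s d = frac t e.
Proof. by move=> h; apply/fracP; exists 1; [exact: denom1|rewrite h]. Qed.

Lemma frac_ind (P : loc -> Prop) : (forall s d, P (frac s d)) -> forall q, P q.
Proof. by move=> Pf q; rewrite -[q]fracK; apply: Pf. Qed.

Definition loc_add p q : loc :=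
  frac (loc_num p * val (loc_den q) + loc_num q * val (loc_den p))
       (denmul (loc_den p) (loc_den q)).
Definition loc_mul p q : loc :=
  frac (loc_num p * loc_num q) (denmul (loc_den p) (loc_den q)).
Definition loc_opp p : loc := frac (- loc_num p) (loc_den p).

Lemma frac_reprP s d : exists2 u, denom u &
  u * (loc_num (frac s d) * val d) = u * (s * val (loc_den (frac s d))).
Proof. by apply/fracP; rewrite fracK. Qed.

Lemma fracD s d t e :
  loc_add (frac s d) (frac t e) = frac (s * val e + t * val d) (denmul d e).
Proof.
have [u Mu us] := frac_reprP s d; have [v Mv vt] := frac_reprP t e.
apply/fracP; exists (u * v); first exact: denom_mul.
rewrite !val_denE; move: us vt; set a := loc_num _; set b := val (loc_den _).
set a' := loc_num _; set b' := val (loc_den _) => us vt.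
transitivity (v * val e * b' * (u * (a * val d)) + u * val d * b * (v * (a' * val e))).
  by ring.
by rewrite us vt; ring.
Qed.

Lemma fracM s d t e : loc_mul (frac s d) (frac t e) = frac (s * t) (denmul d e).
Proof.
have [u Mu us] := frac_reprP s d; have [v Mv vt] := frac_reprP t e.
apply/fracP; exists (u * v); first exact: denom_mul.
rewrite !val_denE; move: us vt; set a := loc_num _; set b := val (loc_den _).
set a' := loc_num _; set b' := val (loc_den _) => us vt.
transitivity ((u * (a * val d)) * (v * (a' * val e))); first by ring.
by rewrite us vt; ring.
Qed.

Lemma fracN s d : loc_opp (frac s d) = frac (- s) d.
Proof.
have [u Mu us] := frac_reprP s d; apply/fracP; exists u => //.
by rewrite !mulNr !mulrN us.
Qed.

Lemma loc_addA : associative loc_add.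
Proof.
elim/frac_ind=> s d; elim/frac_ind=> t e; elim/frac_ind=> r f.
by rewrite !fracD; apply: frac_eq; rewrite !val_denE; ring.
Qed.
Lemma loc_addC : commutative loc_add.
Proof.
elim/frac_ind=> s d; elim/frac_ind=> t e.
by rewrite !fracD; apply: frac_eq; rewrite !val_denE; ring.
Qed.
Lemma loc_add0 : left_id (frac 0 den1) loc_add.
Proof. by elim/frac_ind=> s d; rewrite fracD; apply: frac_eq; rewrite !val_denE; ring. Qed.
Lemma loc_addN : left_inverse (frac 0 den1) loc_opp loc_add.
Proof. by elim/frac_ind=> s d; rewrite fracN fracD; apply: frac_eq; rewrite !val_denE; ring. Qed.
HB.instance Definition _ :=
  GRing.isZmodule.Build loc loc_addA loc_addC loc_add0 loc_addN.

Lemma loc_mulA : associative loc_mul.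
Proof.
elim/frac_ind=> s d; elim/frac_ind=> t e; elim/frac_ind=> r f.
by rewrite !fracM; apply: frac_eq; rewrite !val_denE; ring.
Qed.
Lemma loc_mulC : commutative loc_mul.
Proof.
elim/frac_ind=> s d; elim/frac_ind=> t e.
by rewrite !fracM; apply: frac_eq; rewrite !val_denE; ring.
Qed.
Lemma loc_mul1 : left_id (frac 1 den1) loc_mul.
Proof. by elim/frac_ind=> s d; rewrite fracM; apply: frac_eq; rewrite !val_denE; ring. Qed.
Lemma loc_mulDl : left_distributive loc_mul +%R.
Proof.
elim/frac_ind=> s d; elim/frac_ind=> t e; elim/frac_ind=> r f.
rewrite -[_ + _]/(loc_add (frac s d) (frac t e)) fracD !fracM -[RHS]/(loc_add _ _).
by rewrite fracD; apply: frac_eq; rewrite !val_denE; ring.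
Qed.
HB.instance Definition _ := GRing.Zmodule_isComPzRing.Build loc
  loc_mulA loc_mulC loc_mul1 loc_mulDl.

Definition loc_of (s : S) : loc := frac s den1.

Lemma loc_ofD : {morph loc_of : s t / s + t}.
Proof. by move=> s t; rewrite [RHS]fracD; apply: frac_eq; rewrite !val_denE; ring. Qed.
Lemma loc_ofM : {morph loc_of : s t / s * t}.
Proof. by move=> s t; rewrite [RHS]fracM; apply: frac_eq; rewrite !val_denE; ring. Qed.
Lemma loc_of1 : loc_of 1 = 1.
Proof. by []. Qed.

(* s/d for any d in S; it is 0 if d is not an admissible denominator *)
Definition loc_div (s d : S) : loc :=
  if insub d is Some d' then frac s d' else 0.

End Localization.

(* the matrix of l |-> l - <a^vee, l> a *)
Definition refl_mx n (a : 'cV[int]_n) (av : 'rV[int]_n) : 'M[int]_n :=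
  1%:M - a *m av.

(* Reduced semisimple root data, which classify the split semisimple groups
   with a split maximal torus. The character lattice T^* is Z^n, as column
   vectors, and its dual consists of row vectors. *)
Record root_datum (n : nat) := RootDatum {
  roots : seq 'cV[int]_n;
  coroot : 'cV[int]_n -> 'rV[int]_n;
  coroot_inj : {in roots &, injective coroot};
  coroot_root : {in roots, forall a, coroot a *m a = 2%:M};
  refl_root : {in roots &, forall a b, refl_mx a (coroot a) *m b \in roots};
  refl_coroot : {in roots &, forall a b,
    exists2 c, c \in roots & coroot b *m refl_mx a (coroot a) = coroot c};
  roots_reduced : {in roots &, forall a b, forall i j : int,
    i != 0 -> i *: a = j *: b -> b = a \/ b = - a};
  roots_span : forall l, exists2 N : int, N != 0 &
    exists c : 'cV[int]_n -> int, N *: l = \sum_(a <- roots) c a *: a }.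

Section WeylGroup.
Variables (n : nat) (D : root_datum n).

Definition rd_root : predArgType := seq_sub (roots D).
HB.instance Definition _ := Finite.on rd_root.
HB.instance Definition _ := SubType.on rd_root.

Definition root_refl (a : rd_root) : 'M[int]_n := refl_mx (val a) (coroot D (val a)).

Definition refl_prod (r : seq rd_root) : 'M[int]_n :=
  foldr (fun a M => root_refl a *m M) 1%:M r.

Definition in_weyl (w : 'M[int]_n) : Prop := exists r, w = refl_prod r.

Definition weyl : predArgType := {w : 'M[int]_n | `[< in_weyl w >]}.
HB.instance Definition _ := SubType.on weyl.
HB.instance Definition _ := [Choice of weyl by <:].

Lemma refl_prod_cat r s : refl_prod (r ++ s) = refl_prod r *m refl_prod s.
Proof. by elim: r => [|a r IHr] /=; rewrite ?mul1mx // IHr mulmxA. Qed.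

Lemma root_reflK a : root_refl a *m root_refl a = 1%:M.
Proof.
rewrite /root_refl /refl_mx; set b := val a; set bv := coroot D b.
have e : bv *m b = 2%:M by apply: coroot_root; apply: ssvalP.
rewrite mulmxBl !mulmxBr !mulmx1 !mul1mx mulmxA -(mulmxA b) e.
by rewrite mul_mx_scalar -scalemxAl scaler_nat mulr2n opprB addrK subrK.
Qed.

Lemma refl_prod_rev r : refl_prod (rev r) *m refl_prod r = 1%:M.
Proof.
elim: r => [|a r IHr]; first by rewrite mulmx1.
rewrite rev_cons -cats1 refl_prod_cat /= mulmx1.
by rewrite -mulmxA (mulmxA (root_refl a)) root_reflK mul1mx.
Qed.

Lemma in_weyl1 : in_weyl 1%:M. Proof. by exists [::]. Qed.
Lemma in_weylM v w : in_weyl v -> in_weyl w -> in_weyl (v *m w).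
Proof. by move=> [r ->] [s ->]; exists (r ++ s); rewrite refl_prod_cat. Qed.
Lemma in_weyl_refl a : in_weyl (root_refl a).
Proof. by exists [:: a]; rewrite /= mulmx1. Qed.
Lemma in_weylV w : in_weyl w -> exists2 v, in_weyl v & v *m w = 1%:M.
Proof.
by move=> [r ->]; exists (refl_prod (rev r)); [exists (rev r)|exact: refl_prod_rev].
Qed.

Lemma weylP (w : weyl) : in_weyl (val w). Proof. exact/asboolP/(valP w). Qed.

Definition weyl_of w (Ww : in_weyl w) : weyl := exist _ w (introT (asboolP _) Ww).
Definition weyl_one : weyl := weyl_of in_weyl1.
Definition weyl_mul (v w : weyl) : weyl := weyl_of (in_weylM (weylP v) (weylP w)).
Definition weyl_inv (w : weyl) : weyl :=
  let: exist2 v Wv _ := cid2 (in_weylV (weylP w)) in weyl_of Wv.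
Definition weyl_refl (a : rd_root) : weyl := weyl_of (in_weyl_refl a).

Lemma weyl_root (w : weyl) (a : rd_root) : val w *m val a \in roots D.
Proof.
have [r ->] := weylP w; elim: r => [|b r IHr] /=; first by rewrite mul1mx ssvalP.
by rewrite -mulmxA; apply: refl_root => //; apply: ssvalP.
Qed.

(* A Weyl group element is determined by its permutation of the roots. *)
Definition weyl_perm (w : weyl) : {ffun rd_root -> rd_root} :=
  [ffun a => SeqSub (weyl_root w a)].

Lemma weyl_perm_inj : injective weyl_perm.
Proof.
move=> v w vw; apply: val_inj.
have vwl (l : 'cV[int]_n) : val v *m l = val w *m l.
  have [N N0 [c lN]] := roots_span D l.
  suff /matrixP e : N *: (val v *m l) = N *: (val w *m l).
    by apply/matrixP => i j; have := e i j; rewrite !mxE => /(mulfI N0).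
  rewrite !scalemxAr lN !mulmx_sumr big_seq [RHS]big_seq; apply: eq_bigr => a aD.
  rewrite -!scalemxAr; congr (_ *: _).
  by have /ffunP/(_ (SeqSub aD)) := vw; rewrite !ffunE => -[].
apply/matrixP => i j; have /colP/(_ i) := vwl (delta_mx j 0).
by rewrite -!colE !mxE.
Qed.

Lemma weyl_permK : pcancel weyl_perm
  (fun p => if pselect (exists w, weyl_perm w = p) is left e
            then Some (projT1 (cid e)) else None).
Proof.
move=> w; case: pselect => [e|[]]; last by exists w.
by case: cid => v /= /weyl_perm_inj ->.
Qed.
HB.instance Definition _ : isCountable weyl := PCanIsCountable weyl_permK.
HB.instance Definition _ : isFinite weyl := PCanIsFinite weyl_permK.

Lemma weyl_mulA : associative weyl_mul.
Proof. by move=> u v w; apply: val_inj; apply: mulmxA. Qed.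
Lemma weyl_mul1 : left_id weyl_one weyl_mul.
Proof. by move=> w; apply: val_inj; apply: mul1mx. Qed.
Lemma weyl_mulV : left_inverse weyl_one weyl_inv weyl_mul.
Proof.
by move=> w; apply: val_inj; rewrite /= /weyl_inv; case: cid2.
Qed.
HB.instance Definition _ :=
  Finite_isGroup.Build weyl weyl_mulA weyl_mul1 weyl_mulV.

End WeylGroup.

Section Demazure.
Variables (n : nat) (D : root_datum n) (R : comPzRingType) (F : psr bool R).
Local Notation S := (fgr n F).
Local Notation W := (weyl D).

Definition Sigma_regular : Prop :=
  forall (a : rd_root D) (s : S), fgr_x F (val a) * s = 0 -> s = 0.

Definition root_var (s : S) : Prop := exists a : rd_root D, s = fgr_x F (val a).

Definition locQ : Type := loc root_var.
HB.instance Definition _ := GRing.ComPzRing.on locQ.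

(* w(s/d) = w(s)/w(d); w permutes the variables x_a of the roots, so that w(d)
   is again an admissible denominator *)
Definition locQ_act (w : W) (q : locQ) : locQ :=
  loc_div root_var (fgr_act (val w) (loc_num q)) (fgr_act (val w) (val (loc_den q))).

(* Q_W; its element \sum_w q_w delta_w is the family (q_w)_w *)
Definition QW : Type := {ffun W -> locQ^o}.
HB.instance Definition _ := GRing.Lmodule.on QW.

Definition delta (w : W) : QW := [ffun v => (v == w)%:R].

Definition qw_mul (a b : QW) : QW :=
  \sum_w \sum_v (a w * locQ_act w (b v)) *: delta (w * v)%g.

Definition QW_of (q : locQ) : QW := q *: delta 1%g.
Definition QW_ofS (s : S) : QW := QW_of (loc_of root_var s).

Definition push_pull (a : rd_root D) : QW :=
  QW_of (loc_div root_var 1 (fgr_x F (- val a)))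
  + loc_div root_var 1 (fgr_x F (val a)) *: delta (weyl_refl a).

(* The subalgebra generated by S and the push-pull elements: S enters through
   1 and the scalings. *)
Inductive in_demazure : QW -> Prop :=
  | demazure_one : in_demazure (delta 1%g)
  | demazure_push_pull a : in_demazure (push_pull a)
  | demazure_add a b : in_demazure a -> in_demazure b -> in_demazure (a + b)
  | demazure_scale s a : in_demazure a -> in_demazure (loc_of root_var s *: a)
  | demazure_mul a b : in_demazure a -> in_demazure b -> in_demazure (qw_mul a b).

Definition demazure_pred : {pred QW} := fun a => `[< in_demazure a >].

Lemma demazureP a : reflect (in_demazure a) (a \in demazure_pred).
Proof. exact: asboolP. Qed.

Lemma loc_of0 : loc_of root_var 0 = 0.
Proof. by apply: (addIr (loc_of root_var 0)); rewrite -loc_ofD !add0r. Qed.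

Lemma loc_ofN1 : loc_of root_var (- 1) = - 1.
Proof. by apply: (addIr (loc_of root_var 1)); rewrite -loc_ofD !addNr loc_of0. Qed.

Lemma demazure_zmod_closed : zmod_closed demazure_pred.
Proof.
split=> [|a b /demazureP Da /demazureP Db]; apply/demazureP.
  by rewrite -(scale0r (delta 1%g)) -loc_of0; apply/demazure_scale/demazure_one.
by rewrite -scaleN1r -loc_ofN1; apply/demazure_add/demazure_scale.
Qed.
HB.instance Definition _ :=
  GRing.isZmodClosed.Build QW demazure_pred demazure_zmod_closed.

Definition demazure : Type := {a : QW | a \in demazure_pred}.
HB.instance Definition _ := SubType.on demazure.
HB.instance Definition _ := [Choice of demazure by <:].
HB.instance Definition _ := [SubChoice_isSubZmodule of demazure by <:].

Definition demazure_of a (Da : in_demazure a) : demazure :=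
  exist _ a (introT (demazureP a) Da).

Lemma demazureW (a : demazure) : in_demazure (val a).
Proof. exact/demazureP/(valP a). Qed.

Definition dem_scale (s : S) (a : demazure) : demazure :=
  demazure_of (demazure_scale s (demazureW a)).
Definition dem_mul (a b : demazure) : demazure :=
  demazure_of (demazure_mul (demazureW a) (demazureW b)).
Definition dem_push_pull (a : rd_root D) : demazure :=
  demazure_of (demazure_push_pull a).

Lemma dem_scaleA s t a : dem_scale s (dem_scale t a) = dem_scale (s * t) a.
Proof. by apply: val_inj; rewrite /= scalerA -loc_ofM. Qed.
Lemma dem_scale1 : left_id 1 dem_scale.
Proof. by move=> a; apply: val_inj; rewrite /= loc_of1 scale1r. Qed.
Lemma dem_scaleDr : right_distributive dem_scale +%R.
Proof. by move=> s a b; apply: val_inj; rewrite /= scalerDr. Qed.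
Lemma dem_scaleDl a : {morph dem_scale^~ a : s t / s + t}.
Proof. by move=> s t; apply: val_inj; rewrite /= loc_ofD scalerDl. Qed.
HB.instance Definition _ := GRing.Zmodule_isLmodule.Build S demazure
  dem_scaleA dem_scale1 dem_scaleDr dem_scaleDl.

Lemma qw_mulDl : left_distributive qw_mul +%R.
Proof.
move=> a b c; rewrite /qw_mul -big_split; apply: eq_bigr => w _.
by rewrite -big_split; apply: eq_bigr => v _; rewrite ffunE mulrDl scalerDl.
Qed.
Lemma qw_mulZl q a b : qw_mul (q *: a) b = q *: qw_mul a b.
Proof.
rewrite /qw_mul scaler_sumr; apply: eq_bigr => w _.
rewrite scaler_sumr; apply: eq_bigr => v _.
by rewrite scalerA ffunE mulrA.
Qed.

(* [demdual], the dual of D_F, stands for the equivariant cohomology of G/B. *)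
Definition QWdual : Type := {linear QW -> locQ^o}.
Definition demdual : Type := {linear demazure -> S^o}.

(* the actions (z . f)(z') = f(z' z) of Q_W and of D_F on their duals *)
Definition hecke_fun (z : QW) (f : QWdual) : QW -> locQ^o :=
  fun z' => f (qw_mul z' z).
Fact hecke_linear z f : linear (hecke_fun z f).
Proof. by move=> q a b; rewrite /hecke_fun qw_mulDl qw_mulZl linearP. Qed.
HB.instance Definition _ z f :=
  GRing.isLinear.Build locQ QW locQ^o _ (hecke_fun z f) (hecke_linear z f).
Definition hecke (z : QW) (f : QWdual) : QWdual := hecke_fun z f.

Definition dem_hecke_fun (z : demazure) (f : demdual) : demazure -> S^o :=
  fun z' => f (dem_mul z' z).
Fact dem_hecke_linear z f : linear (dem_hecke_fun z f).
Proof.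
move=> s a b; rewrite /dem_hecke_fun -linearP; congr (f _).
by apply: val_inj; rewrite /= qw_mulDl qw_mulZl.
Qed.
HB.instance Definition _ z f :=
  GRing.isLinear.Build S demazure S^o _ (dem_hecke_fun z f) (dem_hecke_linear z f).
Definition dem_hecke (z : demazure) (f : demdual) : demdual := dem_hecke_fun z f.

(* The coefficients (p_w)_w of the image \sum_w p_w f_w of an element of the
   dual of D_F in the dual of S_W, that is, its values on the delta_w. When F is
   of additive type, delta_w = x_a push_pull a + 1 for w = s_a, so that S_W is
   contained in D_F and the default value 0 is never used. *)
Definition dem_coef (f : demdual) (w : W) : S :=
  f (insubd (0 : demazure) (delta w)).

(* \sum_w p_w f_w in Q_W^*, where f_w(\sum_v q_v delta_v) = q_w *)
Definition SW_dual_fun (p : W -> S) : QW -> locQ^o :=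
  fun z => \sum_w loc_of root_var (p w) * z w.
Fact SW_dual_linear p : linear (SW_dual_fun p).
Proof.
move=> q a b; rewrite /SW_dual_fun scaler_sumr -big_split.
by apply: eq_bigr => w _; rewrite !ffunE mulrDr mulrCA.
Qed.
HB.instance Definition _ p :=
  GRing.isLinear.Build locQ QW locQ^o _ (SW_dual_fun p) (SW_dual_linear p).
Definition SW_dual (p : W -> S) : QWdual := SW_dual_fun p.

End Demazure.

(* The localized operation C_T, which sends \sum_w p_w f_w to
   \sum_w C(p_w) f_w. Its values lie in the dual of D_{F2}, regarded as a
   subset of Q_W^*. *)
Definition localized_op (n : nat) (D : root_datum n) (R1 R2 : comPzRingType)
    (F1 : psr bool R1) (F2 : psr bool R2) (phi : {rmorphism R1 -> R2})
    (gamma : psr unit R2) (z : demdual D F1) : QWdual D F2 :=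
  SW_dual (fun w => fgr_map F2 phi gamma (dem_coef z w)).

(* Main.v *)
From HB Require Import structures.
From mathcomp Require Import all_boot all_order all_algebra all_fingroup.
From mathcomp Require Import finmap boolp ring.
From mathcomp.multinomials Require Import monalg.
Require Import Defs.

Set Implicit Arguments.
Unset Strict Implicit.
Unset Printing Implicit Defensive.
Import GRing.Theory.
Local Open Scope ring_scope.

(** Both sides are Q-linear functionals on Q_W, so they are compared on the
    basis elements delta_w ([QWdual_ext]). Write s = s_a and p_w = z(delta_w).

    For a formal group law of additive type, x_(-a) = - x_a ([fgr_xN]), hence
    Y_a = (1/x_a) (delta_s - 1) and
    delta_w Y_a = (1/x_(wa)) (delta_(ws) - delta_w)  ([delta_push_pull]).
    In particular delta_s = x_a Y_a + 1 lies in the Demazure algebra, and so does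
    every delta_w ([in_demazure_delta]). Evaluating the S-linear form z on
    x_(wa) delta_w Y_a = delta_(ws) - delta_w shows that the coefficients p'_w of
    Y_a . z satisfy x_(wa) p'_w = p_(ws) - p_w in S_1 ([dem_coef_push_pull]).

    The map C : S_1 -> S_2 is additive and multiplicative and sends x_l to
    gamma(x_l) = x_l itd(x_l) ([fgr_map_x]), so that
    C(p_(ws)) - C(p_w) = x_(wa) itd(x_(wa)) C(p'_w).
    Up to the factor 1/x_(wa), the left-hand side is the value of Y_a . C_T(z) at
    delta_w, and itd(x_(wa)) C(p'_w) is that of itd(x_a) . C_T(Y_a . z), because
    delta_w itd(x_a) = itd(x_(wa)) delta_w.

    The work lies in showing that C and the action of W on S are well-defined
    ring homomorphisms. Substitution of series without constant term is
    continuous for the degree filtration and agrees on truncations with the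
    evaluation of polynomials ([subst_approx]); from this it follows that it is a
    ring homomorphism ([substM]) and that substitutions compose ([subst_comp]). A
    substitution whose values satisfy the defining relations of S modulo the
    closed ideal descends to S ([subst_descends]): the relations give the ideal
    they generate, and continuity gives its closure. *)

(** * Power series up to a given degree *)

Section Truncation.
Context {I : choiceType} {R : comPzRingType}.
Implicit Types f g h : psr I R.

(** [eq_upto N f 0] expresses that [f] has order at least [N]. *)
Definition eq_upto N f g : Prop := forall e, (e < N)%N -> f e = g e.

Lemma eq_upto_sym N f g : eq_upto N f g -> eq_upto N g f.
Proof. by move=> fg e eN; rewrite fg. Qed.

Lemma eq_upto_trans N f g h : eq_upto N f g -> eq_upto N g h -> eq_upto N f h.
Proof. by move=> fg gh e eN; rewrite fg // gh. Qed.

Lemma eq_upto_leq M N f g : (M <= N)%N -> eq_upto N f g -> eq_upto M f g.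
Proof. by move=> MN fg e eM; apply: fg; apply: leq_trans MN. Qed.

Lemma eq_uptoD N f f' g g' :
  eq_upto N f f' -> eq_upto N g g' -> eq_upto N (f + g) (f' + g').
Proof. by move=> ff' gg' e eN /=; rewrite ff' // gg'. Qed.

Lemma eq_uptoM N f f' g g' :
  eq_upto N f f' -> eq_upto N g g' -> eq_upto N (f * g) (f' * g').
Proof.
move=> ff' gg' e eN; apply: eq_bigr => i _.
by rewrite ff' ?gg' //; [apply: leq_ltn_trans (leq_subr _ _) eN
  | apply: leq_ltn_trans (leq_ord i) eN].
Qed.

Lemma eq_upto_sum N T (r : seq T) (P : pred T) (F G : T -> psr I R) :
  (forall i, P i -> eq_upto N (F i) (G i)) ->
  eq_upto N (\sum_(i <- r | P i) F i) (\sum_(i <- r | P i) G i).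
Proof.
move=> FG; apply: (big_ind2 (eq_upto N)) => // f f' g g'; exact: eq_uptoD.
Qed.

Lemma hpart_sum T (r : seq T) (P : pred T) (F : T -> psr I R) d :
  (\sum_(i <- r | P i) F i) d = \sum_(i <- r | P i) F i d.
Proof. exact: (big_morph (fun f : psr I R => f d)). Qed.

Lemma eq_upto_all f g : (forall N, eq_upto N f g) -> f = g.
Proof. by move=> fg; apply: psrP => d; apply: (fg d.+1). Qed.

Lemma eq_upto0_mul M N f g :
  eq_upto M f 0 -> eq_upto N g 0 -> eq_upto (M + N) (f * g) 0.
Proof.
move=> f0 g0 e eMN; apply: big1 => i _.
case: (ltnP i M) => iM; first by rewrite f0 // mul0r.
by rewrite g0 ?mulr0 // ltn_subLR ?leq_ord // (leq_trans eMN) // leq_add2r.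
Qed.

Lemma eq_upto0_exp f m : f 0%N = 0 -> eq_upto m (f ^+ m) 0.
Proof.
move=> f0; elim: m => // m IHm; rewrite exprS -add1n; apply: eq_upto0_mul => //.
by case.
Qed.

Lemma psCD : {morph (@psC I R) : a b / a + b}.
Proof. by move=> a b; apply: psrP => -[|d] /=; rewrite ?monomD ?addr0. Qed.

Lemma psCM : {morph (@psC I R) : a b / a * b}.
Proof.
move=> a b; apply: psrP => -[|d] /=; rewrite /ps_mul_part big_ord_recl /=.
  rewrite big_ord0 addr0; have := pmulUU a b (mone : {cmonom I}) mone.
  by rewrite mul1m => <-.
by rewrite mulr0 add0r big1 // => i _; rewrite mul0r.
Qed.

End Truncation.
Arguments eq_upto_sym {I R N f g} fg : rename.
Arguments eq_upto_trans {I R N f g h} fg gh : rename.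
Arguments eq_upto_leq {I R M N f g} MN fg : rename.
Arguments eq_uptoD {I R N f f' g g'} ff' gg' : rename.
Arguments eq_uptoM {I R N f f' g g'} ff' gg' : rename.
Arguments eq_upto_sum {I R N T r P F G} FG : rename.
Arguments eq_upto0_mul {I R M N f g} f0 g0 : rename.

(** * Substitution *)

Section Substitution.
Context {I J : choiceType} {R R' : comPzRingType}.
Variables (phi : {rmorphism R -> R'}) (g : I -> psr J R').
Implicit Types (p q : pol I R) (k l : {cmonom I}).

Definition monom_eval k : psr J R' := \prod_(i <- finsupp k) g i ^+ k i.

Lemma monom_evalEw (d : {fset I}) k : (finsupp k `<=` d)%fset ->
  monom_eval k = \prod_(i <- d) g i ^+ k i.
Proof.
move=> kd; apply: (big_fset_incl _ kd) => i _.
by rewrite -cmE_eq0 => /eqP ->; rewrite expr0.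
Qed.

Lemma monom_evalM k l : monom_eval (mmul k l) = monom_eval k * monom_eval l.
Proof.
rewrite /monom_eval mdomD -/(monom_eval k) -/(monom_eval l).
rewrite (monom_evalEw (fsubsetUl (finsupp k) (finsupp l))).
rewrite (monom_evalEw (fsubsetUr (finsupp k) (finsupp l))) -big_split /=.
by apply: eq_bigr => i _; rewrite cmM exprD.
Qed.

Lemma monom_eval1 : monom_eval mone = 1.
Proof. by rewrite /monom_eval mdom1 big_seq_fset0. Qed.

Lemma monom_evalU i : monom_eval (ucm i) = g i.
Proof. by rewrite /monom_eval mdomU big_seq_fset1 cmUU expr1. Qed.

Let term k (c : R) : psr J R' := psC (phi c) * monom_eval k.
Let termD k : {morph term k : a b / a + b}.
Proof. by move=> a b; rewrite /term rmorphD psCD mulrDl. Qed.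

Lemma pol_evalD : {morph pol_eval phi g : p q / p + q}.
Proof. exact: (pol_sumD termD). Qed.

Lemma pol_evalU c k : pol_eval phi g (monom c k) = psC (phi c) * monom_eval k.
Proof. exact: (pol_sumU termD). Qed.

Lemma pol_eval0 : pol_eval phi g 0 = 0.
Proof. by apply: (addIr (pol_eval phi g 0)); rewrite -pol_evalD !add0r. Qed.

Lemma pol_evalM : {morph pol_eval phi g : p q / p * q}.
Proof.
move=> p q; elim/(@pol_ind I R): p => [|p p' IHp IHp'|a k].
- by rewrite mul0r pol_eval0 mul0r.
- by rewrite mulrDl !pol_evalD IHp IHp' mulrDl.
elim/(@pol_ind I R): q => [|q q' IHq IHq'|b l].
- by rewrite mulr0 pol_eval0 mulr0.
- by rewrite mulrDr !pol_evalD IHq IHq' mulrDr.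
have -> : monom a k * monom b l = monom (a * b) (mmul k l) :> pol I R.
  exact: pmulUU.
by rewrite !pol_evalU rmorphM psCM monom_evalM mulrACA.
Qed.

Lemma pol_eval_sum T (r : seq T) (P : pred T) (F : T -> pol I R) :
  pol_eval phi g (\sum_(i <- r | P i) F i)
  = \sum_(i <- r | P i) pol_eval phi g (F i).
Proof. exact: (big_morph _ pol_evalD pol_eval0). Qed.

Hypothesis g0 : forall i, g i 0%N = 0.

Lemma monom_eval_order k : eq_upto (mdeg k) (monom_eval k) 0.
Proof.
rewrite mdegE /monom_eval.
apply: (big_ind2 (fun (N : nat) h => eq_upto N h 0)) => //.
  by move=> M f N h; apply: eq_upto0_mul.
by move=> i _; apply: eq_upto0_exp.
Qed.

Lemma pol_eval_order N p : homog N p -> eq_upto N (pol_eval phi g p) 0.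
Proof.
move=> hp; rewrite /pol_eval big_seq.
elim/big_ind: _ => // [f h f0 h0|k kp].
  by rewrite -[0]addr0; apply: eq_uptoD.
rewrite -[N]add0n; apply: eq_upto0_mul => //.
by rewrite -(hp _ kp); apply: monom_eval_order.
Qed.

(** Since the [g i] have positive order, degrees at least [N] of [f] contribute
    nothing below [N]. All properties of [subst] are deduced from those of
    [pol_eval], which is a ring homomorphism, through this congruence. *)
Lemma subst_approx N f :
  eq_upto N (subst phi g f) (\sum_(e < N) pol_eval phi g (f e)).
Proof.
move=> d dN; rewrite hpart_sum /= /subst_part.
rewrite (big_ord_widen _ (fun e => pol_eval phi g (f e) d) dN).
rewrite big_mkcond; apply: eq_bigr => e _; rewrite ltnS; case: leqP => // de.
by rewrite (pol_eval_order (@hpart_homog _ _ f _)).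
Qed.

Arguments monom_eval_order k : clear implicits.
Arguments pol_eval_order {N p} hp.
Arguments subst_approx N f : clear implicits.

Lemma substD : {morph subst phi g : f h / f + h}.
Proof.
move=> f h; apply: psrP => d; rewrite /= /subst_part -big_split.
by apply: eq_bigr => e _; rewrite pol_evalD.
Qed.

Lemma subst0 : subst phi g 0 = 0.
Proof. by apply: (addIr (subst phi g 0)); rewrite -substD !add0r. Qed.

Lemma subst_sum T (r : seq T) (P : pred T) (F : T -> psr I R) :
  subst phi g (\sum_(i <- r | P i) F i) = \sum_(i <- r | P i) subst phi g (F i).
Proof. exact: (big_morph _ substD subst0). Qed.

Lemma substM : {morph subst phi g : f h / f * h}.
Proof.
move=> f h; apply: eq_upto_all => N; apply: eq_upto_sym.
(* The truncation of f * h keeps the products f i * h j with i + j < N, the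
   product of the truncations those with i, j < N; the others have order
   at least N. *)
apply: eq_upto_trans (eq_uptoM (subst_approx _ _) (subst_approx _ _)) _.
apply: eq_upto_trans (eq_upto_sym (subst_approx _ _)).
pose G i j := pol_eval phi g (f i) * pol_eval phi g (h j).
have -> : \sum_(e < N) pol_eval phi g ((f * h) e)
    = \sum_(i < N) \sum_(e < N | (i <= e)%N) G i (e - i)%N.
  rewrite [RHS](exchange_big_dep predT) //=; apply: eq_bigr => e _.
  rewrite pol_eval_sum.
  rewrite (big_ord_widen N (fun i => pol_eval phi g (f i * h (e - i)%N))) //.
  by apply: eq_big => [i|i _]; rewrite ?ltnS // pol_evalM.
rewrite mulr_suml; apply: eq_upto_sum => i _; rewrite mulr_sumr.
have -> : \sum_(e < N | (i <= e)%N) G i (e - i)%N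
    = \sum_(j < N | (j < N - i)%N) G i j.
  rewrite -(big_mkord (fun e => i <= e)%N (fun e => G i (e - i)%N)).
  rewrite -(big_nat_widenl i 0 N xpredT) // -{1}[val i]add0n big_addn.
  rewrite -(big_mkord (fun j => j < N - i)%N (G i)).
  rewrite -(big_nat_widen 0 _ _ xpredT) ?leq_subr //.
  by apply: eq_bigr => j _; rewrite addnK.
rewrite [X in eq_upto _ _ X]big_mkcond; apply: eq_upto_sum => j _.
case: leqP => // Nj.
have := eq_upto0_mul (pol_eval_order (@hpart_homog _ _ f i))
                     (pol_eval_order (@hpart_homog _ _ h j)).
by apply: eq_upto_leq; rewrite -leq_subLR.
Qed.

Lemma subst_psC c : subst phi g (psC c) = psC (phi c).
Proof.
apply: eq_upto_all => N; apply: (@eq_upto_leq _ _ _ N.+1) => //.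
apply: eq_upto_trans (subst_approx _ _) _; rewrite big_ord_recl /= big1.
  by rewrite pol_evalU monom_eval1 mulr1 addr0.
by move=> i _; rewrite pol_eval0.
Qed.

Lemma subst_psX i : subst phi g (psX i) = g i.
Proof.
apply: eq_upto_all => N; apply: (@eq_upto_leq _ _ _ N.+2); first exact: ltnW.
apply: eq_upto_trans (subst_approx _ _) _; rewrite !big_ord_recl /= big1.
  by rewrite pol_eval0 pol_evalU monom_evalU rmorph1 mul1r add0r addr0.
by move=> j _; rewrite pol_eval0.
Qed.

Lemma subst_eq_upto N (f h : psr I R) :
  eq_upto N f h -> eq_upto N (subst phi g f) (subst phi g h).
Proof.
move=> fh e eN; apply: eq_bigr => i _.
by rewrite fh // (leq_ltn_trans _ eN) // leq_ord.
Qed.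

Lemma subst_const (f : psr I R) : f 0%N = 0 -> subst phi g f 0%N = 0.
Proof.
by move=> f0; rewrite /= /subst_part big_ord_recl big_ord0 /= f0 pol_eval0 addr0.
Qed.

End Substitution.
Arguments subst_approx {I J R R'} phi {g} g0 N f.
Arguments subst_eq_upto {I J R R'} phi g {N f h} fh.

Section Composition.
Context {I J K : choiceType} {R R' R'' : comPzRingType}.
Variables (phi : {rmorphism R -> R'}) (g : I -> psr J R').
Variables (psi : {rmorphism R' -> R''}) (h : J -> psr K R'').
Hypotheses (g0 : forall i, g i 0%N = 0) (h0 : forall j, h j 0%N = 0).

(** By continuity it is enough to compare the two sides on polynomials, where
    the ring homomorphism [subst psi h] commutes with sums and products. *)
Lemma subst_comp f :
  subst psi h (subst phi g f) = subst (psi \o phi) (subst psi h \o g) f.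
Proof.
pose Ta := GRing.isNmodMorphism.Build _ _ _ (subst0 psi h, substD psi h).
have S1 : subst psi h 1 = 1 by rewrite (subst_psC psi h0 1) rmorph1.
pose Tm := GRing.isMonoidMorphism.Build _ _ _ (S1, substM psi h0).
pose T : {rmorphism psr J R' -> psr K R''} := HB.pack (subst psi h) Ta Tm.
apply: eq_upto_all => N.
apply: eq_upto_trans (subst_eq_upto psi h (subst_approx phi g0 N f)) _.
have Tg0 i : (subst psi h \o g) i 0%N = 0 by apply: subst_const.
apply: eq_upto_trans (eq_upto_sym (subst_approx (psi \o phi) Tg0 N f)).
have -> // : subst psi h (\sum_(e < N) pol_eval phi g (f e))
  = \sum_(e < N) pol_eval (psi \o phi) (subst psi h \o g) (f e).
rewrite subst_sum; apply: eq_bigr => e _; rewrite /pol_eval subst_sum.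
apply: eq_bigr => k _; rewrite -[subst psi h]/(T : _ -> _) rmorphM rmorph_prod.
congr (_ * _); first exact: subst_psC.
by apply: eq_bigr => i _; rewrite rmorphXn.
Qed.
End Composition.

(** * Series in one variable *)

Section Univariate.
Context {R : comPzRingType}.

Lemma cmonom_unitP (k l : {cmonom unit}) : mdeg k = mdeg l -> k = l.
Proof.
have E (m : {cmonom unit}) : mdeg m = m tt.
  rewrite (@mdegEw _ m [fset tt]%fset) ?big_seq_fset1 //.
  by apply/fsubsetP => -[] _; rewrite in_fset1.
by rewrite !E => kl; apply/eqP/cmP => -[].
Qed.

Lemma homog_unit d (p : pol unit R) :
  homog d p -> p = monom ((p : {malg R[_]})@_(umonom d)) (umonom d).
Proof.
move=> hp; rewrite monom.unlock; apply/malgP => k; rewrite mcoeffU.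
have [<- //|dk] := eqVneq (umonom d) k.
rewrite mcoeff_outdom //; apply/negP => /hp kd; case/eqP: dk.
by apply: cmonom_unitP; rewrite mdeg_umonom kd.
Qed.

Lemma psX_mul_itd (f : psr unit R) : f 0%N = 0 -> f = psX tt * itd f.
Proof.
move=> f0; apply: psrP => -[|d]; rewrite /= /ps_mul_part !big_ord_recl /=.
  by rewrite mul0r add0r big_ord0.
rewrite big1 => [|i _]; last by rewrite mul0r.
rewrite mul0r add0r addr0 subn1 /= [LHS](homog_unit (@hpart_homog _ _ f d.+1)).
by rewrite -[monom _ _ * _]/(pmul _ _) /useries_part pmulUU mul1r.
Qed.

End Univariate.

Lemma subst_ucomp (J K : choiceType) (R R' : comPzRingType)
    (psi : {rmorphism R -> R'}) (h : J -> psr K R') (f : psr unit R)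
    (x : psr J R) :
  x 0%N = 0 -> (forall j, h j 0%N = 0) ->
  subst psi h (ucomp f x) = subst psi (fun=> subst psi h x) f.
Proof. by move=> x0 h0; rewrite /ucomp (subst_comp idfun). Qed.

(** The right-hand side keeps [psi] acting on the coefficients of [F]; when
    [psi] is the identity it is convertible to an [fgl_add]. *)
Lemma subst_fgl_add (J K : choiceType) (R R' : comPzRingType)
    (psi : {rmorphism R -> R'}) (h : J -> psr K R') (F : psr bool R)
    (x y : psr J R) :
  x 0%N = 0 -> y 0%N = 0 -> (forall j, h j 0%N = 0) ->
  subst psi h (fgl_add F x y)
  = subst psi (fun b : bool => if b then subst psi h y else subst psi h x) F.
Proof.
move=> x0 y0 h0; rewrite /fgl_add (subst_comp idfun) => [|[] //|//].
by congr (subst _ _ F); apply/funext => -[].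
Qed.

Lemma ucomp_const (J : choiceType) (R : comPzRingType) (f : psr unit R)
    (x : psr J R) :
  f 0%N = 0 -> ucomp f x 0%N = 0.
Proof. exact: (subst_const idfun). Qed.

Lemma ucomp_itd (J : choiceType) (R : comPzRingType) (f : psr unit R)
    (x : psr J R) :
  f 0%N = 0 -> x 0%N = 0 -> ucomp f x = x * ucomp (itd f) x.
Proof.
move=> f0 x0; rewrite {1}(psX_mul_itd f0) /ucomp.
by rewrite (substM idfun) // (subst_psX idfun).
Qed.

(** * Identities of a formal group law *)

Section FormalGroupLawTheory.
Context {R : comPzRingType} (F : psr bool R) (Ffgl : is_fgl F).
Local Notation "x +_F y" := (fgl_add F x y) (at level 50).

(** The constant term of F(x, 0) = x is that of [F]; being homogeneous of
    degree 0, it is a scalar, which evaluation does not change. *)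
Lemma fgl_const : F 0%N = 0.
Proof.
have /(congr1 (fun f : psr unit R => f 0%N)) := fgl_add0 Ffgl.
rewrite /= /subst_part big_ord_recl big_ord0 addr0 /=.
have -> : F 0%N = monom ((F 0%N : {malg R[_]})@_mone) mone.
  rewrite monom.unlock; apply/malgP => k; rewrite mcoeffU.
  have [<- //|k1] := eqVneq mone k; rewrite mcoeff_outdom //.
  by apply: contra k1 => /hpart_homog/mdeg_eq0I ->.
rewrite (pol_evalU idfun) monom_eval1 mulr1 /=.
move=> /(congr1 (fun p : {malg R[_]} => p@_mone)).
rewrite !monom.unlock mcoeffUU mcoeff0 => ->; exact: monalgU0.
Qed.

Lemma fgl_add_const (J : choiceType) (x y : psr J R) : (x +_F y) 0%N = 0.
Proof. exact: (subst_const idfun _ fgl_const). Qed.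

Context {J : choiceType}.
Implicit Types x y z : psr J R.

Lemma fgl_addC_series x y : x 0%N = 0 -> y 0%N = 0 -> x +_F y = y +_F x.
Proof.
move=> x0 y0; have h0 (b : bool) : (if b then y else x) 0%N = 0 by case: b.
have := congr1 (subst idfun (fun b : bool => if b then y else x)) (fgl_addC Ffgl).
by rewrite !(subst_fgl_add idfun) // !(subst_psX idfun).
Qed.

Lemma fgl_addA_series x y z : x 0%N = 0 -> y 0%N = 0 -> z 0%N = 0 ->
  (x +_F y) +_F z = x +_F (y +_F z).
Proof.
move=> x0 y0 z0.
pose h (i : 'I_3) := if i == 0 then x else if i == 1 then y else z.
have h0 i : h i 0%N = 0 by rewrite /h; case: ifP => // _; case: ifP.
have := congr1 (subst idfun h) (fgl_addA Ffgl).
rewrite /= !(subst_fgl_add idfun) ?fgl_add_const //.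
by rewrite !(subst_psX idfun).
Qed.

Lemma fgl_add0_series x : x 0%N = 0 -> x +_F 0 = x.
Proof.
move=> x0; have := congr1 (subst idfun (fun=> x)) (fgl_add0 Ffgl).
by rewrite !(subst_fgl_add idfun) // !(subst_psX idfun) // (subst0 idfun).
Qed.

Lemma additive_type_series x : additive_type F -> x 0%N = 0 -> x +_F (- x) = 0.
Proof.
move=> [_ FN] x0; have := congr1 (subst idfun (fun=> x)) FN.
rewrite (subst_fgl_add idfun) //=; last by rewrite oppr0.
rewrite (subst0 idfun) (subst_psX idfun) //.
suff -> : subst idfun (fun=> x) (- psX tt) = - x by [].
apply/eqP; rewrite -addr_eq0 -{2}(subst_psX idfun (fun=> x0) tt).
by rewrite -(substD idfun) addNr (subst0 idfun).
Qed.

End FormalGroupLawTheory.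

(** * The formal group ring *)

Section FormalGroupRingTheory.
Context {n : nat} {R : comPzRingType} (F : psr bool R).
Local Notation A := (psr 'cV[int]_n R).
Local Notation S := (fgr n F).
Local Notation pi := (@fgr_pi n R F).

Lemma fgr_pi0 : pi 0 = 0.
Proof. by apply: (addIr (pi 0)); rewrite -fgr_piD !add0r. Qed.

Fact fgr_pi_nmod_morphism : nmod_morphism pi.
Proof. by split; [exact: fgr_pi0|exact: fgr_piD]. Qed.
Fact fgr_pi_monoid_morphism : monoid_morphism pi.
Proof. by split=> //; exact: fgr_piM. Qed.
HB.instance Definition _ :=
  GRing.isNmodMorphism.Build A S pi fgr_pi_nmod_morphism.
HB.instance Definition _ :=
  GRing.isMonoidMorphism.Build A S pi fgr_pi_monoid_morphism.

Lemma fgr_pi_opp f : pi (- f) = - pi f. Proof. exact: rmorphN. Qed.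
Lemma fgr_pi_sub f h : pi (f - h) = pi f - pi h. Proof. exact: rmorphB. Qed.
Lemma fgr_pi_mul f h : pi (f * h) = pi f * pi h. Proof. exact: rmorphM. Qed.

(** The quotient is separated: the ideal of the relations has been replaced by
    its closure. *)
Lemma fgr_pi_lim (f h : A) :
  (forall N, exists f' h',
     [/\ eq_upto N f f', eq_upto N h h' & pi f' = pi h']) -> pi f = pi h.
Proof.
move=> fh; apply/fgr_piP/asboolP => N.
have [f' [h' [ff' hh' /fgr_piP/asboolP/(_ N) [j Jj fj]]]] := fh N.
by exists j => // e eN; rewrite -fj //= ff' // hh'.
Qed.

Lemma fgr_x0 : fgr_x F (0 : 'cV[int]_n) = 0.
Proof.
rewrite -fgr_pi0; apply/fgr_piP; rewrite subr0; apply/asboolP => N.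
by exists (psX 0) => // P _; apply; left.
Qed.

Lemma fgr_xD (l m : 'cV[int]_n) :
  fgr_x F (l + m) = pi (fgl_add F (psX l) (psX m)).
Proof.
apply/fgr_piP; apply/asboolP => N; eexists; last by move=> e _.
by move=> P _; apply; right; exists l, m.
Qed.

(** For polynomials this holds because [pi] is a ring homomorphism, and
    separatedness passes it to the limit. *)
Lemma subst_congr (I : choiceType) (R' : comPzRingType)
    (phi : {rmorphism R' -> R}) (g g' : I -> A) (f : psr I R') :
  (forall i, g i 0%N = 0) -> (forall i, g' i 0%N = 0) ->
  (forall i, pi (g i) = pi (g' i)) -> pi (subst phi g f) = pi (subst phi g' f).
Proof.
move=> g0 g'0 gg'; apply: fgr_pi_lim => N.
exists (\sum_(e < N) pol_eval phi g (f e)), (\sum_(e < N) pol_eval phi g' (f e)).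
split; [exact: subst_approx|exact: subst_approx|].
rewrite !rmorph_sum; apply: eq_bigr => e _.
rewrite !rmorph_sum; apply: eq_bigr => k _.
rewrite !rmorphM !rmorph_prod; congr (_ * _); apply: eq_bigr => i _.
by rewrite !rmorphXn; congr (_ ^+ _); exact: gg'.
Qed.

Section Descent.
Context {R' : comPzRingType} {F' : psr bool R'} (phi : {rmorphism R' -> R}).
Variable g : 'cV[int]_n -> A.
Hypotheses (g0 : forall l, g l 0%N = 0) (g_0 : pi (g 0) = 0).
Hypothesis gD : forall l m,
  pi (g (l + m)) = pi (subst phi (fun b : bool => if b then g m else g l) F').

(** The series that [subst phi g] sends to 0 in S form an ideal, which contains
    the relations of the source and hence the ideal generated by them;
    continuity and separatedness extend this to the closure. *)
Lemma subst_descends (f h : psr 'cV[int]_n R') :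
  fgr_pi F' f = fgr_pi F' h -> pi (subst phi g f) = pi (subst phi g h).
Proof.
move=> /fgr_piP/asboolP fh; apply/eqP; rewrite -subr_eq0 -fgr_pi_sub; apply/eqP.
have -> : subst phi g f - subst phi g h = subst phi g (f - h).
  by apply: (addIr (subst phi g h)); rewrite -substD !subrK.
rewrite -[RHS]fgr_pi0; apply: fgr_pi_lim => N; have [j Jj fj] := fh N.
exists (subst phi g j), 0; split=> //; first exact: subst_eq_upto.
rewrite fgr_pi0; apply: (Jj (fun j => pi (subst phi g j) = 0)).
  split=> [|a b a0 b0|a b b0]; first by rewrite subst0 fgr_pi0.
    by rewrite substD fgr_piD a0 b0 addr0.
  by rewrite substM // fgr_pi_mul b0 mulr0.
move=> _ [->|[l [m ->]]]; first by rewrite subst_psX.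
pose r := fgl_add F' (psX l) (psX m).
apply/eqP; rewrite -(inj_eq (addIr (pi (subst phi g r)))).
rewrite -fgr_piD -substD subrK add0r subst_psX // gD.
by rewrite subst_fgl_add // !subst_psX.
Qed.
End Descent.

Section Action.
Variable w : 'M[int]_n.

Lemma fgr_act_pi (f : A) :
  fgr_act w (pi f) = pi (subst idfun (fun l => psX (w *m l)) f).
Proof.
rewrite /fgr_act.
apply: (@subst_descends R F idfun (fun l => psX (w *m l))) => //;
  last exact: fgr_reprK.
  by rewrite mulmx0; exact: fgr_x0.
move=> l m; rewrite mulmxDr -/(fgr_x F _) fgr_xD.
by congr (pi (subst _ _ _)); apply/funext => -[].
Qed.

Lemma fgr_act_x l : fgr_act w (fgr_x F l) = fgr_x F (w *m l).
Proof. by rewrite fgr_act_pi (subst_psX idfun). Qed.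

Lemma fgr_act_ueval f l : fgr_act w (fgr_ueval F f l) = fgr_ueval F f (w *m l).
Proof. by rewrite fgr_act_pi (subst_ucomp idfun) // (subst_psX idfun). Qed.

Lemma fgr_actD : {morph @fgr_act n R F w : s t / s + t}.
Proof.
move=> s t; rewrite -[s]fgr_reprK -[t]fgr_reprK.
move: (fgr_repr s) (fgr_repr t) => f h.
by rewrite -fgr_piD !fgr_act_pi (substD idfun) fgr_piD.
Qed.

Lemma fgr_actM : {morph @fgr_act n R F w : s t / s * t}.
Proof.
move=> s t; rewrite -[s]fgr_reprK -[t]fgr_reprK.
move: (fgr_repr s) (fgr_repr t) => f h.
by rewrite -fgr_pi_mul !fgr_act_pi (substM idfun) // fgr_pi_mul.
Qed.

Lemma fgr_act1 : fgr_act w 1 = 1 :> S.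
Proof. by rewrite -[1]/(pi 1) fgr_act_pi (subst_psC idfun). Qed.
End Action.

(** Modulo the relations, the series x_(-l) and - x_l are both inverses of x_l
    for the group law, and associativity makes the inverse unique. *)
Lemma fgr_xN (Ffgl : is_fgl F) (Fadd : additive_type F) (l : 'cV[int]_n) :
  fgr_x F (- l) = - fgr_x F l.
Proof.
have N0 : (- psX l : A) 0%N = 0 by rewrite /= oppr0.
rewrite /fgr_x -[psX (- l) in LHS](fgl_add0_series Ffgl) //.
(* x_(-l) = F(x_(-l), F(x_l, - x_l)) = F(F(x_(-l), x_l), - x_l) = F(0, - x_l) *)
rewrite -(additive_type_series Fadd (x := psX l : A)) // -fgl_addA_series //.
rewrite -fgr_pi_opp -[- psX l in RHS](fgl_add0_series Ffgl N0).
rewrite [in RHS]fgl_addC_series //.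
apply: (subst_congr idfun) => -[] //; first exact: fgl_add_const.
by rewrite -fgr_xD addNr fgr_x0 fgr_pi0.
Qed.
End FormalGroupRingTheory.

(** * The map C between formal group rings *)

Section FormalGroupRingMap.
Variables (n : nat) (R1 R2 : comPzRingType) (F1 : psr bool R1) (F2 : psr bool R2).
Variables (phi : {rmorphism R1 -> R2}) (gamma : psr unit R2).
Hypothesis F2_fgl : is_fgl F2.
Hypothesis phi_gamma : is_fgl_morphism F1 F2 phi gamma.
Local Notation gx l := (ucomp gamma (psX l)).

Let gamma0 : gamma 0%N = 0. Proof. by case: phi_gamma. Qed.

Lemma fgr_ueval_itd (l : 'cV[int]_n) :
  fgr_ueval F2 gamma l = fgr_x F2 l * fgr_ueval F2 (itd gamma) l.
Proof. by rewrite /fgr_ueval ucomp_itd // fgr_pi_mul. Qed.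

(** The relation x_(l+m) = F_1(x_l, x_m) is respected because gamma(x_(l+m)) is
    gamma(F_2(x_l, x_m)) in S_2, which is phi(F_1)(gamma(x_l), gamma(x_m)) since
    (phi, gamma) is a morphism. *)
Lemma fgr_map_pi (f : psr 'cV[int]_n R1) :
  fgr_map F2 phi gamma (fgr_pi F1 f) = fgr_pi F2 (subst phi (fun l => gx l) f).
Proof.
rewrite /fgr_map.
apply: (@subst_descends n R2 F2 R1 F1 phi (fun l => gx l)) => [l||l m|];
  last exact: fgr_reprK.
- exact: ucomp_const.
- by rewrite -/(fgr_ueval F2 gamma 0) fgr_ueval_itd fgr_x0 mul0r.
pose h (b : bool) : psr 'cV[int]_n R2 := if b then psX m else psX l.
have h0 b : h b 0%N = 0 by case: b.
have x0 (b : bool) : (psX b : psr bool R2) 0%N = 0 by [].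
transitivity (fgr_pi F2 (ucomp gamma (fgl_add F2 (psX l) (psX m)))).
  apply: (subst_congr idfun) => // _; first by rewrite fgl_add_const.
  exact: fgr_xD.
have := congr1 (subst idfun h) phi_gamma.2.
rewrite (subst_ucomp idfun) ?fgl_add_const // (subst_fgl_add idfun) //.
rewrite !(subst_psX idfun) // => E; congr (fgr_pi F2 _).
apply: etrans (esym E) _; rewrite (subst_comp phi idfun) //; last first.
  by move=> b; apply: ucomp_const.
congr (subst _ _ F1); apply/funext => b /=.
by rewrite (subst_ucomp idfun) // (subst_psX idfun) //; case: b.
Qed.

Lemma fgr_map_x (l : 'cV[int]_n) :
  fgr_map F2 phi gamma (fgr_x F1 l) = fgr_x F2 l * fgr_ueval F2 (itd gamma) l.
Proof.
by rewrite fgr_map_pi subst_psX -?fgr_ueval_itd // => k; apply: ucomp_const.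
Qed.

Lemma fgr_mapB (s t : fgr n F1) :
  fgr_map F2 phi gamma (s - t) = fgr_map F2 phi gamma s - fgr_map F2 phi gamma t.
Proof.
apply: (addIr (fgr_map F2 phi gamma t)); rewrite subrK.
rewrite -[s]fgr_reprK -[t]fgr_reprK.
move: (fgr_repr s) (fgr_repr t) => f h.
by rewrite -fgr_pi_sub !fgr_map_pi -fgr_piD -substD subrK.
Qed.

Lemma fgr_mapM (s t : fgr n F1) :
  fgr_map F2 phi gamma (s * t) = fgr_map F2 phi gamma s * fgr_map F2 phi gamma t.
Proof.
rewrite -[s]fgr_reprK -[t]fgr_reprK.
move: (fgr_repr s) (fgr_repr t) => f h.
rewrite -fgr_pi_mul !fgr_map_pi substM ?fgr_pi_mul // => l; exact: ucomp_const.
Qed.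

End FormalGroupRingMap.

(** * Fractions and the action of the Weyl group on them *)

Section LocalizationTheory.
Context {S : comPzRingType} (X : S -> Prop).
Local Notation loc_of := (loc_of X).
Local Notation loc_div := (loc_div X).

Lemma loc_divE (s d : S) (Dd : denom X d) : loc_div s d = frac s (den_of Dd).
Proof.
rewrite /loc_div insubT => [|Dd']; first exact/asboolP.
exact: frac_eq.
Qed.

Lemma frac_loc_div (s : S) (d : den X) : frac s d = loc_div s (val d).
Proof. by rewrite (loc_divE _ (denP d)); apply: frac_eq. Qed.

Lemma loc_of_div (s : S) : loc_of s = loc_div s 1.
Proof. by rewrite -[1](val_den1 X) -frac_loc_div. Qed.

Lemma loc_divK (s d : S) : denom X d -> loc_of d * loc_div s d = loc_of s.
Proof.
move=> Dd; rewrite (loc_divE _ Dd) -[LHS]/(loc_mul _ _) fracM.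
by apply: frac_eq; rewrite !val_denE /=; ring.
Qed.

(** Denominators become invertible, so identities between fractions can be
    checked after clearing them. *)
Lemma loc_of_cancel (d : S) (p q : loc X) :
  denom X d -> loc_of d * p = loc_of d * q -> p = q.
Proof.
move=> Dd /(congr1 (fun r => r * loc_div 1 d)).
by rewrite !(mulrAC _ _ (loc_div 1 d)) loc_divK // loc_of1 !mul1r.
Qed.

End LocalizationTheory.

Section WeylActionLocalized.
Context {n : nat} (D : root_datum n) {R : comPzRingType} (F : psr bool R).
Local Notation S := (fgr n F).
Local Notation W := (weyl D).
Local Notation X := (root_var D (F := F)).
Implicit Types (w v : W) (a : rd_root D).

Definition weyl_act_root w a : rd_root D := SeqSub (weyl_root w a).

Lemma denom_root_var a : denom X (fgr_x F (val a)).
Proof. by apply: denom_gen; exists a. Qed.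

Lemma denom_act w (d : S) : denom X d -> denom X (fgr_act (val w) d).
Proof.
elim=> [|_ e [a ->] _ IHe]; first by rewrite fgr_act1; exact: denom1.
rewrite fgr_actM fgr_act_x; apply: denomM IHe.
by exists (weyl_act_root w a).
Qed.

(** The representative of s/d chosen in [locQ_act] may be another fraction; an
    equation u s d' = u s' d with u a denominator is preserved by w, which
    permutes the variables of the roots. *)
Lemma locQ_act_div w (s d : S) : denom X d ->
  locQ_act w (loc_div X s d) = loc_div X (fgr_act (val w) s) (fgr_act (val w) d).
Proof.
move=> Dd; rewrite (loc_divE s Dd); set d' := den_of Dd.
have [u Du us] := frac_reprP s d'; rewrite /locQ_act.
rewrite (loc_divE _ (denom_act w (denP _))) (loc_divE _ (denom_act w Dd)).
apply/fracP; exists (fgr_act (val w) u); first exact: denom_act.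
by rewrite /= -!fgr_actM us.
Qed.

Lemma locQ_act_of w (s : S) :
  locQ_act w (loc_of X s) = loc_of X (fgr_act (val w) s).
Proof. by rewrite !loc_of_div locQ_act_div ?fgr_act1 //; exact: denom1. Qed.

Lemma locQ_actD w : {morph @locQ_act n D R F w : p q / p + q}.
Proof.
elim/frac_ind=> s d; elim/frac_ind=> t e; rewrite -[_ + _]/(loc_add _ _) fracD.
rewrite !frac_loc_div !locQ_act_div; try exact: denP.
rewrite !val_denE.
rewrite (loc_divE _ (denom_act w (denP d))) (loc_divE _ (denom_act w (denP e))).
rewrite -[RHS]/(loc_add _ _) fracD frac_loc_div.
by rewrite !val_denE /= !fgr_actM fgr_actD !fgr_actM.
Qed.

Lemma locQ_actM w : {morph @locQ_act n D R F w : p q / p * q}.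
Proof.
elim/frac_ind=> s d; elim/frac_ind=> t e; rewrite -[_ * _]/(loc_mul _ _) fracM.
rewrite !frac_loc_div !locQ_act_div; try exact: denP.
rewrite !val_denE.
rewrite (loc_divE _ (denom_act w (denP d))) (loc_divE _ (denom_act w (denP e))).
rewrite -[RHS]/(loc_mul _ _) fracM frac_loc_div.
by rewrite !val_denE /= !fgr_actM.
Qed.

Lemma locQ_act1 w : locQ_act w 1 = 1 :> locQ D F.
Proof. by rewrite -(loc_of1 X) locQ_act_of fgr_act1. Qed.

Lemma locQ_act0 w : locQ_act w 0 = 0 :> locQ D F.
Proof. by apply: (addIr (locQ_act w 0)); rewrite -locQ_actD !add0r. Qed.

End WeylActionLocalized.

(** * Push-pull elements, the Demazure algebra and the Hecke action *)

Section TwistedGroupAlgebra.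
Context {n : nat} (D : root_datum n) {R : comPzRingType} (F : psr bool R).
Local Notation S := (fgr n F).
Local Notation W := (weyl D).
Local Notation X := (root_var D (F := F)).
Local Notation delta := (@delta n D R F).
Local Notation QW := (QW D F).
Implicit Types (w v : W) (a : rd_root D).

Lemma QW_sum_delta (b : QW) : b = \sum_w b w *: delta w.
Proof.
apply/ffunP => v; rewrite sum_ffunE (bigD1 v) // /= [X in _ + X]big1 ?addr0.
  by rewrite !ffunE eqxx; exact/esym/mulr1.
by move=> w wv; rewrite !ffunE eq_sym (negPf wv); exact: mulr0.
Qed.

Lemma QWdual_ext (f g : QWdual D F) :
  (forall w, f (delta w) = g (delta w)) -> f =1 g.
Proof.
move=> fg b; rewrite [b]QW_sum_delta !linear_sum; apply: eq_bigr => w _.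
by rewrite !linearZ fg.
Qed.

Lemma qw_mul_delta_l w (b : QW) :
  qw_mul (delta w) b = \sum_v locQ_act w (b v) *: delta (w * v)%g.
Proof.
rewrite /qw_mul (bigD1 w) // /= [X in _ + X]big1 ?addr0 => [|u uw].
  by apply: eq_bigr => v _; rewrite ffunE eqxx mul1r.
by apply: big1 => v _; rewrite ffunE (negPf uw) mul0r scale0r.
Qed.

Lemma qw_mul_delta w v : qw_mul (delta w) (delta v) = delta (w * v)%g.
Proof.
rewrite qw_mul_delta_l (bigD1 v) // /= [X in _ + X]big1 ?addr0 => [|u uv].
  by rewrite ffunE eqxx locQ_act1 scale1r.
by rewrite ffunE (negPf uv) locQ_act0 scale0r.
Qed.

Lemma qw_mul_deltaB w (b c : QW) :
  qw_mul (delta w) (b - c) = qw_mul (delta w) b - qw_mul (delta w) c.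
Proof.
apply: (addIr (qw_mul (delta w) c)); rewrite subrK !qw_mul_delta_l -big_split.
by apply: eq_bigr => v _ /=; rewrite -scalerDl -locQ_actD !ffunE subrK.
Qed.

Lemma qw_mul_deltaZ w (q : locQ D F) (b : QW) :
  qw_mul (delta w) (q *: b) = locQ_act w q *: qw_mul (delta w) b.
Proof.
rewrite !qw_mul_delta_l scaler_sumr; apply: eq_bigr => v _.
by rewrite scalerA -locQ_actM ffunE.
Qed.

Lemma QWdualZ (f : QWdual D F) (q : locQ D F) (b : QW) : f (q *: b) = q * f b.
Proof. exact: linearZ. Qed.

Hypotheses (Ffgl : is_fgl F) (Fadd : additive_type F).

(** This makes x_(-a) an admissible denominator, as the variable of a root. *)
Lemma fgr_x_reflN a :
  fgr_x F (- val a) = fgr_x F (val (weyl_act_root (weyl_refl a) a)).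
Proof.
congr fgr_x; rewrite /= /root_refl /refl_mx mulmxBl mul1mx -mulmxA.
rewrite coroot_root ?ssvalP // mul_mx_scalar scaler_nat mulr2n.
by rewrite opprD addNKr.
Qed.

Lemma push_pull_additive a :
  push_pull F a
  = loc_div X 1 (fgr_x F (val a)) *: (delta (weyl_refl a) - delta 1%g).
Proof.
have Da : denom X (fgr_x F (val a)) by exact: denom_root_var.
have Dna : denom X (fgr_x F (- val a)).
  by rewrite fgr_x_reflN; exact: denom_root_var.
rewrite /push_pull; have -> : loc_div X 1 (fgr_x F (- val a))
    = - loc_div X 1 (fgr_x F (val a)).
  apply: (loc_of_cancel Dna); rewrite loc_divK // fgr_xN //.
  by rewrite -mulN1r loc_ofM loc_ofN1 mulN1r mulrNN loc_divK.
by rewrite addrC scalerBr /QW_of scaleNr.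
Qed.

Lemma delta_push_pull w a : qw_mul (delta w) (push_pull F a)
  = loc_div X 1 (fgr_x F (val w *m val a))
    *: (delta (w * weyl_refl a)%g - delta w).
Proof.
rewrite push_pull_additive qw_mul_deltaZ qw_mul_deltaB !qw_mul_delta mulg1.
rewrite locQ_act_div ?fgr_act1 ?fgr_act_x //; exact: denom_root_var.
Qed.

(** The Weyl group is generated by the reflections, and
    delta_s = x_a Y_a + 1 for s the reflection of a. *)
Lemma in_demazure_delta w : in_demazure (delta w).
Proof.
have [r] := weylP w; elim: r w => [|a r IHr] w wr.
  have -> : w = 1%g by apply: val_inj.
  exact: demazure_one.
pose v : W := weyl_of (ex_intro _ r erefl).
have -> : w = (weyl_refl a * v)%g by apply: val_inj; rewrite wr.
rewrite -qw_mul_delta; apply: demazure_mul (IHr v erefl).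
have -> : delta (weyl_refl a)
    = loc_of X (fgr_x F (val a)) *: push_pull F a + delta 1%g.
  rewrite push_pull_additive scalerA loc_divK; last exact: denom_root_var.
  by rewrite loc_of1 scale1r subrK.
apply: demazure_add; last exact: demazure_one.
exact/demazure_scale/demazure_push_pull.
Qed.

Lemma dem_coefE (f : demdual D F) w :
  dem_coef f w = f (demazure_of (in_demazure_delta w)).
Proof.
rewrite /dem_coef; congr (f _); apply: val_inj.
by rewrite val_insubd ifT //; exact/demazureP/in_demazure_delta.
Qed.

(** Since delta_w Y_a lies in the Demazure algebra, the S-linearity of [f] gives
    this identity in S itself, before any localization. *)
Lemma dem_coef_push_pull (f : demdual D F) w a :
  fgr_x F (val w *m val a) * dem_coef (dem_hecke (dem_push_pull F a) f) w
  = dem_coef f (w * weyl_refl a)%g - dem_coef f w.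
Proof.
rewrite !dem_coefE -linearB /= /dem_hecke_fun.
rewrite -[LHS]/(fgr_x F _ *: (f _ : S^o)) -linearZ; congr (f _).
apply: val_inj; rewrite /= delta_push_pull scalerA loc_divK ?loc_of1 ?scale1r //.
exact: (denom_root_var F (weyl_act_root w a)).
Qed.

Lemma SW_dual_delta (p : W -> S) w : SW_dual p (delta w) = loc_of X (p w).
Proof.
rewrite /= /SW_dual_fun (bigD1 w) //= big1 ?addr0 => [|v vw].
  by rewrite ffunE eqxx mulr1.
by rewrite ffunE (negPf vw) mulr0.
Qed.

Lemma hecke_ofS_delta (s : S) (p : W -> S) w :
  hecke (QW_ofS D s) (SW_dual p) (delta w) = loc_of X (fgr_act (val w) s * p w).
Proof.
rewrite -[LHS]/(SW_dual p (qw_mul _ _)) qw_mul_deltaZ qw_mul_delta mulg1.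
by rewrite locQ_act_of QWdualZ SW_dual_delta loc_ofM.
Qed.

Lemma hecke_push_pull_delta a (p : W -> S) w :
  loc_of X (fgr_x F (val w *m val a))
    * hecke (push_pull F a) (SW_dual p) (delta w)
  = loc_of X (p (w * weyl_refl a)%g - p w).
Proof.
rewrite -[hecke _ _ _]/(SW_dual p (qw_mul _ _)) delta_push_pull QWdualZ linearB.
rewrite !SW_dual_delta mulrA loc_divK; last first.
  exact: (denom_root_var F (weyl_act_root w a)).
by rewrite loc_of1 mul1r loc_ofD -mulN1r -loc_ofN1 -loc_ofM mulN1r.
Qed.

End TwistedGroupAlgebra.

(** * Comparison of the push-pull operators *)

Theorem proposition6p2 (n : nat) (D : root_datum n) (R1 R2 : comPzRingType)
  (F1 : psr bool R1) (F2 : psr bool R2)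
  (phi : {rmorphism R1 -> R2}) (gamma : psr unit R2)
  (F1_fgl : is_fgl F1) (F2_fgl : is_fgl F2)
  (F1_additive : additive_type F1) (F2_additive : additive_type F2)
  (phi_gamma : is_fgl_morphism F1 F2 phi gamma)
  (S1_regular : Sigma_regular D F1) (S2_regular : Sigma_regular D F2)
  (a : rd_root D) (z : demdual D F1) :
  hecke (QW_ofS D (fgr_ueval F2 (itd gamma) (val a)))
        (localized_op F2 phi gamma (dem_hecke (dem_push_pull F1 a) z))
    =1 hecke (push_pull F2 a) (localized_op F2 phi gamma z).
Proof.
apply: QWdual_ext => w; apply: (@loc_of_cancel _ _ (fgr_x F2 (val w *m val a))).
  exact: (denom_root_var F2 (weyl_act_root w a)).
rewrite hecke_ofS_delta hecke_push_pull_delta // -loc_ofM; congr (loc_of _ _).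
rewrite -(fgr_mapB F2_fgl phi_gamma) -(dem_coef_push_pull F1_fgl F1_additive).
rewrite (fgr_mapM F2_fgl phi_gamma) (fgr_map_x F2_fgl phi_gamma).
by rewrite fgr_act_ueval mulrA.
Qed.
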